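(* Let $G=(V,E,I,O,W)$ be a finite directed edge-weighted multigraph with positive edge weights. For $v_1,v_2\in V$, let $X$ denote the set of paths from $v_1$ to $v_2$ on $G$, and let $(p_r)$ denote the corresponding sequence of weights. Suppose $X$ is non-empty. 1. If there are no strongly connected components on $\mathrm{Vt}(X)$, then $X$ is a finite set. 2. If there is at least one strongly connected component on $\mathrm{Vt}(X)$ and every strongly connected component on $\mathrm{Vt}(X)$ is a cycle, let $c$ be the greatest number of strongly connected components met by a path in $X$. Then $$\lim_{r\to\infty} p_r^{c}/r = s,$$ where $s$ is given by $$\frac1s=\sum_{\substack{\sigma=\sigma_1\cdots\sigma_m\in \mathrm{It}(X)\\ |J_1(\sigma)|=c}}\ \frac{\prod_{i\in J_2(\sigma)}|E(\sigma_i,\sigma_{i+1})|}{c!\,\prod_{i\in J_1(\sigma)}\omega([\sigma_i])},$$ with $\omega(C)$ the cycle weight of the cycle $C$ (empty products equal $1$). 3. If there is at least one strongly connected component on $\mathrm{Vt}(X)$ which is not a cycle, then $$\lim_{r\to\infty} p_r/\log r = s,$$ where $s$ is the smallest of the values $s(C)$, with $C$ ranging over the strongly connected components on $\mathrm{Vt}(X)$ that are not cycles, and $s(C)>0$ the number attached to $C$ by the spectral radius condition given in the context.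
   Context: **Graphs.** $G=(V,E,I,O,W)$: $V,E$ are finite sets (vertices, edges), $I,O:E\to V$ and $W:E\to(0,\infty)$ are functions; $e$ is an edge from $I(e)$ to $O(e)$ with weight $W(e)$. Parallel edges and loops are allowed. $E(u,v)$ is the set of edges from $u$ to $v$. A subset $U\subset V$ induces the graph with vertex set $U$ and the edges $e$ with $I(e),O(e)\in U$. **Paths.** A path is a non-empty finite list of edges $x=x_1\cdots x_k$ with $I(x_{i+1})=O(x_i)$ for $1\le i<k$ (vertices and edges may repeat); it is a path from $I(x_1)$ to $O(x_k)$. Its weight is $W(x)=\sum_i W(x_i)$. $\mathrm{Vt}(x)$ is the set of vertices met by $x$, and $\mathrm{Vt}(X)=\bigcup_{x\in X}\mathrm{Vt}(x)$. The sequence of weights $(p_r)$, $r=1,2,\dots$, of a set of paths $X$ is the enumeration in non-decreasing order, with multiplicity, of the weights $W(x)$, $x\in X$. **Strongly connected components.** $u\to v$ means there is a (non-empty) path from $u$ to $v$; $u\leftrightarrow v$ means $u\to v$ and $v\to u$; $[u]=\{v: u\leftrightarrow v\}$. The strongly connected components are the non-empty classes $[u]$, regarded as induced graphs; those on $\mathrm{Vt}(X)$ are the ones of the graph induced by $\mathrm{Vt}(X)$. (A single vertex with no loop that lies on no closed path belongs to no component.) A path meets a component if it meets one of its vertices. A graph is strongly connected if $u\leftrightarrow v$ for all pairs of vertices $u,v$ (including $u=v$). A cycle is a strongly connected graph in which every vertex has in-degree and out-degree $1$; its cycle weight is the weight of a path going exactly once around it, i.e. the sum of its edge weights. **Itineraries.**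 For a path $x=x_1\cdots x_k$ let $\mathrm{Vl}(x)=I(x_1)I(x_2)\cdots I(x_k)O(x_k)$ be its list of vertices. The itinerary $\mathrm{It}(x)$ is obtained from $\mathrm{Vl}(x)$ by repeatedly replacing three consecutive entries $abc$ of the list with $a\leftrightarrow b\leftrightarrow c$ by $ac$, until no more replacements are possible. $\mathrm{It}(X)=\{\mathrm{It}(x):x\in X\}$ (a finite set). For $\sigma=\sigma_1\cdots\sigma_m\in\mathrm{It}(X)$, $J_1(\sigma)=\{i\in\{1,\dots,m-1\}:\sigma_i\leftrightarrow\sigma_{i+1}\}$ and $J_2(\sigma)=\{1,\dots,m-1\}\setminus J_1(\sigma)$. **The value $s(C)$.** Let $C$ be a strongly connected component that is not a cycle, with its edge weights. Whenever there is more than one edge from $u$ to $v$ in $C$, replace each such edge $e$ by a new vertex $v_e$ and two edges, from $u$ to $v_e$ and from $v_e$ to $v$, each of weight $W(e)/2$. The resulting graph has at most one edge from any vertex to any other; label its vertices $1,\dots,n$, put $a_{ij}=1$ if there is an edge from $j$ to $i$ and $a_{ij}=0$ otherwise, and let $w_{ij}$ be the weight of that edge. Then $s(C)>0$ is the number such that the matrix with entries $a_{ij}e^{-w_{ij}/s(C)}$ (zero where $a_{ij}=0$) has spectral radius $1$. *)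

(* Defs.v *)
From Stdlib Require Export Relation_Operators.
From HB Require Export structures.
From mathcomp Require Export all_boot all_order all_algebra.
From mathcomp Require Export all_classical all_reals all_analysis.
From mathcomp Require Export complex.

Set Implicit Arguments.
Unset Strict Implicit.
Unset Printing Implicit Defensive.

Import Order.TTheory GRing.Theory Num.Theory.
Import numFieldNormedType.Exports.

Local Open Scope classical_set_scope.
Local Open Scope ring_scope.

Record wgraph (R : realType) := WGraph {
  vertex : finType;
  edge : finType;
  src : edge -> vertex;
  dst : edge -> vertex;
  wt : edge -> R;
  wt_gt0 : forall e, 0 < wt e }.

Arguments src {R w} _.
Arguments dst {R w} _.
Arguments wt {R w} _.

Section Induced.
Context {R : realType} (G : wgraph R) (U : {set vertex G}).

Definition induced_vertex : finType := {u : vertex G | u \in U}.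
Definition induced_edge : finType :=
  {e : edge G | (src e \in U) && (dst e \in U)}.

Definition induced_src (e : induced_edge) : induced_vertex :=
  exist _ (src (val e)) (proj1 (andP (valP e))).
Definition induced_dst (e : induced_edge) : induced_vertex :=
  exist _ (dst (val e)) (proj2 (andP (valP e))).

Definition induced : wgraph R :=
  @WGraph R induced_vertex induced_edge induced_src induced_dst
    (fun e => wt (val e)) (fun e => wt_gt0 (val e)).

End Induced.

Section Graph.
Context {R : realType} (G : wgraph R).
Implicit Types (u v : vertex G) (x : seq (edge G)) (s t : seq (vertex G)).

Definition edges_between u v : {set edge G} :=
  [set e | (src e == u) && (dst e == v)]%SET.

Definition path_between u v x : bool :=
  if x is e :: x' then
    [&& src e == u, path (fun e1 e2 => src e2 == dst e1) e x'
      & dst (last e x') == v]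
  else false.

Definition paths u v : set (seq (edge G)) := [set x | path_between u v x].

Definition path_weight x : R := \sum_(e <- x) wt e.

Definition vertex_list x : seq (vertex G) :=
  if x is e :: x' then rcons (map src x) (dst (last e x')) else [::].

Definition Vt (X : set (seq (edge G))) : {set vertex G} :=
  [set v | `[< exists2 x, X x & v \in vertex_list x >]]%SET.

(* [p] lists the weights of the paths of [X], with multiplicity; the indices
   are the [r] with [1 <= r <= |X|], and the other values of [p] (among them
   [p 0]) are irrelevant. *)
Definition enumerates_weights (X : set (seq (edge G))) (p : nat -> R) : Prop :=
  let D := [set r | (0 < r)%N /\ (`I_r #<= X)%card] in
  (forall q r, D q -> D r -> (q <= r)%N -> p q <= p r) /\
  exists x : nat -> seq (edge G),
    set_bij D X x /\ forall r, D r -> p r = path_weight (x r).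

Definition weight_seq (X : set (seq (edge G))) : nat -> R :=
  get (enumerates_weights X).

Definition reaches u v : Prop := exists x, path_between u v x.

Definition mutual u v : bool := `[< reaches u v /\ reaches v u >].

Definition scc_of u : {set vertex G} := [set v | mutual u v]%SET.

(* A class [scc_of u] may be empty, as [mutual] is not reflexive. *)
Definition sccs : {set {set vertex G}} :=
  [set scc_of u | u : vertex G & scc_of u != finset.set0]%SET.

Definition strongly_connected : Prop := forall u v, mutual u v.

Definition is_cycle : Prop :=
  strongly_connected /\
  forall v, #|[set e : edge G | dst e == v]%SET| = 1%N /\
            #|[set e : edge G | src e == v]%SET| = 1%N.

Definition cycle_weight : R := \sum_(e : edge G) wt e.

Definition itinerary_step s t : Prop :=
  exists l a b c r, [/\ s = l ++ [:: a, b, c & r], t = l ++ [:: a, c & r],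
                        mutual a b & mutual b c].

Definition is_itinerary x s : Prop :=
  clos_refl_trans _ itinerary_step (vertex_list x) s /\
  forall t, ~ itinerary_step s t.

Definition itineraries (X : set (seq (edge G))) : set (seq (vertex G)) :=
  [set s | exists2 x, X x & is_itinerary x s].

(* The positions in [s] are counted from 0; [d] is a default for [nth] that is
   never reached. *)
Definition J1 d s : {set 'I_(size s).-1} :=
  [set i : 'I_(size s).-1 | mutual (nth d s i) (nth d s i.+1)]%SET.
Definition J2 d s : {set 'I_(size s).-1} := (~: J1 d s)%SET.

End Graph.

(* The strongly connected components of the graph induced by [U], as sets of
   vertices of [G]; for such a set [C] the component itself is [induced C]. *)
Definition sccs_on (R : realType) (G : wgraph R) (U : {set vertex G}) :
    {set {set vertex G}} :=
  [set [set val u | u in (C : {set vertex (induced U)})]%SET | C in sccs (induced U)]%SET.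

Definition nb_sccs_met (R : realType) (G : wgraph R) (U : {set vertex G})
    (x : seq (edge G)) : nat :=
  #|[set C in sccs_on U | [exists v in C, v \in vertex_list x]]%SET|.

Section Subdivision.
Context {R : realType} (C : wgraph R).

Definition parallel (e : edge C) : bool :=
  (1 < #|edges_between (src e) (dst e)|)%N.

Definition subdiv_vertex : finType :=
  (vertex C + {e : edge C | parallel e})%type.

(* [inr (e, false)] and [inr (e, true)] are the first and second half of [e]. *)
Definition subdiv_edge : finType :=
  ({e : edge C | ~~ parallel e} + {e : edge C | parallel e} * bool)%type.

Definition subdiv_src (e : subdiv_edge) : subdiv_vertex :=
  match e with
  | inl e => inl (src (val e))
  | inr (e, false) => inl (src (val e))
  | inr (e, true) => inr e
  end.

Definition subdiv_dst (e : subdiv_edge) : subdiv_vertex :=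
  match e with
  | inl e => inl (dst (val e))
  | inr (e, false) => inr e
  | inr (e, true) => inl (dst (val e))
  end.

Definition subdiv_wt (e : subdiv_edge) : R :=
  match e with
  | inl e => wt (val e)
  | inr (e, _) => wt (val e) / 2
  end.

Lemma subdiv_wt_gt0 e : 0 < subdiv_wt e.
Proof. by case: e => [e|[e b]] /=; rewrite ?divr_gt0 ?wt_gt0. Qed.

Definition subdivision : wgraph R :=
  @WGraph R subdiv_vertex subdiv_edge subdiv_src subdiv_dst subdiv_wt
    subdiv_wt_gt0.

End Subdivision.

(* For a graph with at most one edge from any vertex to any other; the entry
   (i, j) belongs to the edge from [j] to [i]. *)
Definition exp_matrix (R : realType) (H : wgraph R) (s : R) :
    'M[R]_#|vertex H| :=
  \matrix_(i, j)
    if [pick e in edges_between (enum_val j) (enum_val i)] is Some e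
    then expR (- wt e / s) else 0.

(* Eigenvalues are taken over the complex numbers. *)
Definition spectral_radius (R : realType) (n : nat) (A : 'M[R]_n) : R :=
  sup [set Normc.normc z | z in
       [set z : R[i] | eigenvalue (map_mx (real_complex R) A) z]].

Definition s_value (R : realType) (C : wgraph R) : R :=
  get [set s : R | 0 < s /\
       spectral_radius (exp_matrix (subdivision C) s) = 1].

(* Main.v *)
Require Import Defs.
From mathcomp Require Import finmap ring lra zify.
Import Order.TTheory GRing.Theory Num.Theory.
Import numFieldNormedType.Exports.
Local Open Scope classical_set_scope.
Local Open Scope ring_scope.

Set Implicit Arguments.
Unset Strict Implicit.
Unset Printing Implicit Defensive.

(** Let [N t] be the number of paths from [v1] to [v2] of weight at most [t].
    Since [p] lists the weights in non-decreasing order, [r <= N (p r)], and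
    [N t < r] for all [t < p r] ([weight_seq_count]).  Hence [p] is an inverse of
    [N], and its asymptotics follow from those of [N]
    ([exponential_growth_limit], [polynomial_growth_limit]).  Splitting off the
    first edge of a walk gives the recursion
      [N_u t = [u = v2 and 0 <= t] + sum over the edges e from u of
        N_(dst e) (t - wt e)]
    ([cnt_walks_rec]), and all estimates are comparisons of solutions of such
    recursions, by induction on [t] in steps of a positive length.

    If a component [C] is not a cycle, there are [h > 0] and a positive vector
    [x] with [x u = sum of exp (- h wt e) x (dst e)], the sum being over the edges
    of [C] from [u] ([not_cycle_fixpoint]).  They are found by maximizing [h] over
    the compact set of pairs [(h, x)] with [x] on the unit simplex and [x]
    bounded by the sum ([transfer_fixpoint]); this is the argument of Collatz and
    Wielandt for the Perron eigenvector, applied to [h] in place of the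
    eigenvalue.  The vector extends to the subdivided graph and shows that
    the spectral radius there is [1] at [1 / h] and at no other argument, that is,
    [s_value C = 1 / h] ([s_value_unique]).  The function [x u exp (h t)] solves
    the recursion inside [C], so it bounds the number of walks from below
    ([walk_count_lower]).  If [h'] exceeds the exponents of all components, the
    vectors of the components, scaled by the powers of a large constant, form a
    positive supersolution at [h'] on the whole graph ([supersolution]), and
    [N t] is at most a multiple of [exp (h' t)] ([walk_count_upper]).  Both bounds
    together give [p r / ln r --> 1 / h] for the largest exponent [h].

    If all components are cycles, [N] is split according to itineraries.  Along
    an itinerary, two consecutive entries that share no component multiply the
    count by a number of edges, while two entries on a cycle of weight [omega]
    give the equation [f t = g (t - d) + f (t - omega)], obtained by unrolling the
    recursion once around the cycle ([iwalks_cycle]).  Its solution is a discrete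
    integral of [g / omega]: growth [L t^m] of [g] becomes growth
    [L / ((m + 1) omega) t^(m + 1)] of [f] ([poly_growth_cycle]).  So an itinerary
    contributes its summand in the formula for [1 / s] times the power of [t]
    whose exponent is the number of its pairs on cycles ([iwalks_growth]).  This
    exponent is the number of components along an edge of which the path runs
    ([njump_shorten]); it is at most [c], and it equals [c] for some path because
    a path can be made to run around every component that it meets
    ([met_njump]). *)

(** * Counting in finite sets *)

Definition cnt (T : choiceType) (A : set T) : nat := #|` fset_set A|.

Section Counting.
Variables (T : choiceType).
Implicit Types A B : set T.

Lemma cnt_le A B : finite_set B -> A `<=` B -> (cnt A <= cnt B)%N.
Proof.
move=> fB AB; have fA := sub_finite_set AB fB.
rewrite /cnt; apply: fsubset_leq_card; apply/fsubsetP => x.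
by rewrite !in_fset_set // => /set_mem/AB/mem_set.
Qed.

Lemma cnt0 A : A = set0 -> cnt A = 0%N.
Proof. by move=> ->; rewrite /cnt fset_set0. Qed.

Lemma cnt1 (x : T) : cnt [set x] = 1%N.
Proof. by rewrite /cnt fset_set1 cardfs1. Qed.

Lemma cnt_gt0 A x : finite_set A -> A x -> (0 < cnt A)%N.
Proof.
by move=> fA Ax; rewrite -(cnt1 x); apply: cnt_le => // y ->.
Qed.

Lemma cnt_image (U : choiceType) (f : U -> T) (A : set U) :
  injective f -> finite_set A -> cnt (f @` A) = cnt A.
Proof.
move=> fi fA; rewrite /cnt fset_set_image // card_imfset //.
Qed.

Lemma cnt_partition (I : eqType) (f : T -> I) (s : seq I) A :
  uniq s -> finite_set A -> (forall x, A x -> f x \in s) ->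
  cnt A = (\sum_(i <- s) cnt (A `&` [set x | f x = i]))%N.
Proof.
move=> us fA As.
under eq_bigr => i _.
  rewrite /cnt card_fset_sum1.
  rewrite (_ : \sum_(_ <- _) 1 =
               \sum_(x <- fset_set A | f x == i) 1)%N; last first.
    rewrite -[RHS]big_filter; apply: perm_big; apply: uniq_perm => //.
      by rewrite filter_uniq.
    move=> x; rewrite mem_filter !in_fset_set //; last exact: finite_setIl.
    apply/idP/andP => [/set_mem[Ax <-]|[/eqP fx /set_mem Ax]].
      by rewrite eqxx; split => //; apply/mem_set.
    by apply/mem_set.
  over.
rewrite (exchange_big_dep xpredT) //= /cnt card_fset_sum1.
rewrite big_seq [RHS]big_seq; apply: eq_bigr => x.
rewrite in_fset_set // => /set_mem/As fxs.
rewrite -big_filter (_ : [seq i <- s | f x == i] = [:: f x]) ?big_seq1 //.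
rewrite (@eq_filter _ _ (pred1 (f x))) ?filter_pred1_uniq // => i.
Qed.

End Counting.

Lemma size_le_cnt (T : choiceType) (A : set T) (s : seq T) :
  finite_set A -> uniq s -> (forall x, x \in s -> A x) -> (size s <= cnt A)%N.
Proof.
move=> fA us sA; apply: uniq_leq_size => // x xs.
by rewrite in_fset_set //; apply/mem_set/sA.
Qed.

Lemma cnt_le_size (T : choiceType) (A : set T) (s : seq T) :
  (forall x, A x -> x \in s) -> (cnt A <= size s)%N.
Proof.
move=> As; rewrite /cnt; apply: uniq_leq_size => // x.
have fA : finite_set A.
  by apply: (@sub_finite_set _ _ [set` s]) => [y /As//|]; exact: finite_seq.
by rewrite in_fset_set // => /set_mem/As.
Qed.

Lemma cnt_setU (T : choiceType) (A B : set T) : finite_set A -> finite_set B ->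
  (forall x, A x -> ~ B x) -> cnt (A `|` B) = (cnt A + cnt B)%N.
Proof.
move=> fA fB AB; have fAB : finite_set (A `|` B) by rewrite finite_setU.
rewrite (@cnt_partition _ _ (fun x => `[< A x >]) [:: true; false]) //.
  rewrite big_cons big_seq1; congr addn; congr cnt; apply/seteqP; split => x /=.
  - by case=> _ /asboolP.
  - by move=> Ax; split; [left|exact/asboolP].
  - by case=> [[Ax|//]] /asboolP.
  - by move=> Bx; split; [right|apply/asboolP => /AB].
by move=> x _; case: `[< _ >].
Qed.

Lemma finite_seq_size (T : finType) (n : nat) :
  finite_set [set x : seq T | (size x <= n)%N].
Proof.
rewrite (_ : [set _ | _] = (fun x : n.-bseq T => val x) @` setT); last first.
  apply/seteqP; split => x /=.
    by move=> sx; exists (Bseq sx).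
  by move=> [y _ <-]; exact: size_bseq.
by apply: finite_image; exact: finite_finset.
Qed.

(** Classifying sequences by their first entry turns counts into recursions. *)
Lemma cnt_cons (T : finType) (A : set (seq T)) : finite_set A ->
  cnt A = (`[< A [::] >] + \sum_(e : T) cnt [set x | A (e :: x)])%N.
Proof.
move=> fA.
rewrite (@cnt_partition _ _ (@ohead T) (None :: [seq Some e | e <- enum T])) //.
- rewrite big_cons big_map big_enum /=; congr (_ + _)%N.
    case: asboolP => A0.
      rewrite (_ : _ `&` _ = [set [::]]) ?cnt1 //.
      by apply/seteqP; split => [[|e x] [] //|x -> //].
    by apply: cnt0; apply/seteqP; split => [[|e x] [] //|x //].
  apply: eq_bigr => e _.
  rewrite -(@cnt_image _ _ (cons e) [set x | A (e :: x)]).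
  + congr cnt; apply/seteqP; split => [[|d x] [] // Ax [<-]|x [y Ay <-]].
      by exists x.
    by split.
  + by move=> x y [].
  + apply: (@finite_preimage _ _ A (cons e)) => //.
    by move=> x y _ _ [].
- rewrite cons_uniq map_inj_uniq ?enum_uniq ?andbT; last by move=> x y [].
  by apply/mapP => -[].
- move=> [|e x] _; rewrite inE //=; apply/map_f/mem_enum.
Qed.

(** * A Perron--Frobenius theorem with a parameter *)

Lemma fin_lower_bound (R : realType) (I : finType) (f : I -> R) :
  (forall i, 0 < f i) -> exists2 m : R, 0 < m & forall i, m <= f i.
Proof.
move=> f0; exists (\big[Order.min/1]_i f i); last by move=> i; exact: bigmin_le_cond.
by elim/big_ind: _ => // x y x0 y0; rewrite lt_min x0.
Qed.

Lemma fin_upper_bound (R : realType) (I : finType) (f : I -> R) :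
  exists2 M : R, 0 < M & forall i, f i <= M.
Proof.
exists (1 + \sum_i `|f i|) => [|i].
  by rewrite ltr_wpDr // sumr_ge0.
rewrite (bigD1 i) //=; have := ler_norm (f i).
have : 0 <= \sum_(j | j != i) `|f j| by exact: sumr_ge0.
lra.
Qed.

Section FunctionSpace.
Variables (R : realType) (V : finType).

(** A product space, so that the cube is compact by Tychonoff's theorem. *)
Definition vec : topologicalType :=
  prod_topology (fun _ : V => (R : topologicalType)).
Definition coord (x : vec) (v : V) : R := x v.

Lemma coord_continuous v : continuous (fun p : R * vec => coord p.2 v).
Proof.
move=> p; apply: (@continuous_comp _ _ _ snd (fun x => coord x v)).
  exact: cvg_snd.
exact: (@proj_continuous V (fun _ => (R : topologicalType)) v).
Qed.

Lemma param_continuous (g : R -> R) :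
  continuous g -> continuous (fun p : R * vec => g p.1).
Proof.
move=> cg p; apply: (@continuous_comp _ _ _ fst g); last exact: cg.
exact: cvg_fst.
Qed.

Lemma box_compact (b : R) :
  compact [set p : R * vec | 0 <= p.1 <= b /\ forall v, 0 <= coord p.2 v <= 1].
Proof.
rewrite (_ : [set _ | _] = `[0, b]%classic `*`
    [set x : vec | forall v, `[0, 1]%classic (coord x v)]); last first.
  by apply/seteqP; split => -[t x] /=; rewrite in_itv.
apply: compact_setX; first exact: segment_compact.
have := @tychonoff V (fun _ => (R : topologicalType)) (fun _ => `[0, 1]%classic).
by apply=> v; exact: segment_compact.
Qed.

Lemma continuous_fsum (T : topologicalType) (I : finType)
    (P : pred I) (F : I -> T -> R) :
  (forall i, P i -> continuous (F i)) ->
  continuous (fun x => \sum_(i | P i) F i x).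
Proof.
exact: (@continuous_big R I +%R 0 P (@add_continuous R) T (index_enum I) F).
Qed.

Lemma continuous_mul (T : topologicalType) (f g : T -> R) :
  continuous f -> continuous g -> continuous (fun x => f x * g x).
Proof. by move=> cf cg x; apply: cvgM; [exact: cf|exact: cg]. Qed.

Lemma continuous_sub (T : topologicalType) (f g : T -> R) :
  continuous f -> continuous g -> continuous (fun x => f x - g x).
Proof. by move=> cf cg x; apply: cvgB; [exact: cf|exact: cg]. Qed.

End FunctionSpace.

Section Transfer.
Variables (R : realType) (V E : finType) (src dst : E -> V) (c w : E -> R).

(** The weighted adjacency operator with entries [c e * expR (- (tau * w e))];
    the coefficients [c] make it serve both for [tau] as growth exponent and, with
    [w] constant, for [expR tau] as eigenvalue of a fixed matrix. *)
Definition transfer (tau : R) (x : V -> R) (v : V) : R :=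
  \sum_(e | src e == v) c e * expR (- (tau * w e)) * x (dst e).

Hypothesis c_gt0 : forall e, 0 < c e.
Hypothesis w_gt0 : forall e, 0 < w e.

Let coef_gt0 tau e : 0 < c e * expR (- (tau * w e)).
Proof. by rewrite mulr_gt0 // expR_gt0. Qed.

Lemma transfer_ge0 tau x v : (forall u, 0 <= x u) -> 0 <= transfer tau x v.
Proof.
by move=> x0; apply: sumr_ge0 => e _; rewrite mulr_ge0 // ltW.
Qed.

Lemma transfer_le tau x y v :
  (forall u, x u <= y u) -> transfer tau x v <= transfer tau y v.
Proof.
by move=> xy; apply: ler_sum => e _; rewrite ler_wpM2l // ltW.
Qed.

Lemma transfer_lt tau x y e : (forall u, x u <= y u) -> x (dst e) < y (dst e) ->
  transfer tau x (src e) < transfer tau y (src e).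
Proof.
move=> xy xye; rewrite /transfer (bigD1 e) //= [X in _ < X](bigD1 e) //=.
apply: ltr_leD; first by rewrite ltr_pM2l.
by apply: ler_sum => d _; rewrite ler_wpM2l // ltW.
Qed.

Lemma transferD tau x y v :
  transfer tau (fun u => x u + y u) v = transfer tau x v + transfer tau y v.
Proof. by rewrite -big_split; apply: eq_bigr => e _; rewrite mulrDr. Qed.

Lemma transferZ tau a x v :
  transfer tau (fun u => a * x u) v = a * transfer tau x v.
Proof. by rewrite mulr_sumr; apply: eq_bigr => e _; rewrite mulrCA. Qed.

(** Edges have positive weight, so a strict inequality survives a small
    increase of the parameter. *)
Lemma transfer_strict_shift tau x : (forall v, 0 <= x v) ->
  (forall v, x v < transfer tau x v) ->
  exists2 d, 0 < d & forall v, x v <= transfer (tau + d) x v.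
Proof.
move=> x0 xF.
have [m m0 mP] : exists2 m : R, 0 < m & forall v, m <= transfer tau x v - x v.
  by apply: fin_lower_bound => v; rewrite subr_gt0.
have [W W0 WP] := fin_upper_bound w.
have [M M0 MP] := fin_upper_bound (transfer tau x).
(* [d] is such that the loss [d * W * transfer tau x v] is at most the gap [m]. *)
exists (m / (W * M)) => [|v]; first by rewrite divr_gt0 // mulr_gt0.
set d := m / (W * M).
have d0 : 0 < d by rewrite divr_gt0 // mulr_gt0.
have dWM : d * W * M = m by rewrite /d -mulrA divfK // gt_eqF // mulr_gt0.
have step : (1 - d * W) * transfer tau x v <= transfer (tau + d) x v.
  rewrite mulr_sumr; apply: ler_sum => e _; rewrite mulrA ler_wpM2r //.
  rewrite mulrCA ler_pM2l // [(tau + d) * _]mulrDl opprD expRD mulrC.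
  rewrite ler_pM2l ?expR_gt0 //.
  apply: le_trans (expR_ge1Dx _); rewrite lerD2l lerN2.
  by rewrite ler_pM2l.
have h : d * W * transfer tau x v <= m.
  by rewrite -dWM ler_pM2l // mulr_gt0.
by apply: le_trans step; rewrite mulrBl mul1r; have := mP v; lra.
Qed.

(** The graph is strongly connected: the only non-empty set of vertices closed
    under predecessors is the whole graph. *)
Hypothesis irreducible : forall P : pred V, (exists v, P v) ->
  (forall e, P (dst e) -> P (src e)) -> forall v, P v.

(** Since the transfer operator [F] is linear, replacing [x] by [x + F x] makes
    the inequality strict at all predecessors of the vertices where it already
    was; by irreducibility the strict set grows until it is everything. *)
Lemma transfer_make_strict tau x : (forall v, 0 <= x v) ->
  (forall v, x v <= transfer tau x v) -> (exists v, x v < transfer tau x v) ->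
  exists y, (forall v, 0 <= y v) /\ forall v, y v < transfer tau y v.
Proof.
have [n] := ubnP #|[pred v | x v == transfer tau x v]|.
elim: n x => // n IH x; rewrite ltnS => xn x0 xF [u xu].
have [/existsP[e /andP[es ed]]|/existsPn noe] :=
  boolP [exists e, (x (dst e) < transfer tau x (dst e)) &&
                   ~~ (x (src e) < transfer tau x (src e))]; last first.
  exists x; split => //.
  apply: (@irreducible (fun v => x v < transfer tau x v)); first by exists u.
  by move=> e es; have := noe e; rewrite es /= negbK.
pose y v := x v + transfer tau x v.
have xFF v : transfer tau x v <= transfer tau (transfer tau x) v.
  exact: transfer_le.
apply: (IH y).
- apply: leq_trans xn; apply: proper_card; apply/properP; split.
    apply/fintype.subsetP => v; rewrite !inE /y transferD => /eqP yv.
    by rewrite eq_le xF /=; move: (xFF v) (xF v); lra.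
  exists (src e).
    by rewrite inE eq_le xF /= leNgt.
  rewrite inE /y transferD; have := transfer_lt tau xF es.
  by have := xF (src e); move=> ? ?; rewrite lt_eqF //; lra.
- by move=> v; rewrite addr_ge0 // transfer_ge0.
- by move=> v; rewrite /y transferD lerD.
- exists u; rewrite /y transferD; have := xFF u; lra.
Qed.

(** The support of a nonnegative fixed vector is closed under predecessors. *)
Lemma transfer_fix_gt0 tau x : (forall v, 0 <= x v) -> (exists v, 0 < x v) ->
  (forall v, transfer tau x v = x v) -> forall v, 0 < x v.
Proof.
move=> x0 xpos xF; apply: irreducible => // e xe.
rewrite -xF; apply: le_lt_trans (transfer_ge0 tau (src e) (fun=> lexx 0)) _.
exact: transfer_lt.
Qed.

Lemma transfer_continuous v :
  continuous (fun p : R * vec R V => transfer p.1 (coord p.2) v).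
Proof.
have cg e : continuous (fun t : R => c e * expR (- (t * w e))).
  move=> t; apply: (@continuous_comp _ _ _ (fun t : R => expR (- (t * w e)))).
    rewrite (_ : (fun t => expR (- (t * w e))) = expR \o ( *%R^~ (- w e))).
      apply: continuous_comp; last exact: continuous_expR.
      exact: mulrr_continuous.
    by apply/funext => u /=; rewrite mulrN.
  exact: mulrl_continuous.
apply: (@continuous_fsum R (R * vec R V)%type E (fun e => src e == v)
    (fun e p => c e * expR (- (p.1 * w e)) * coord p.2 (dst e))) => e _.
exact: (@continuous_mul R (R * vec R V)%type
  (fun p => c e * expR (- (p.1 * w e))) (fun p => coord p.2 (dst e))
  (param_continuous (@cg e)) (@coord_continuous R V (dst e))).
Qed.

(** The admissible pairs [(tau, x)] with [x] on the unit simplex form a compact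
    set; at one with [tau] maximal the inequality [x <= F x] is an equality,
    since otherwise it could be made strict and [tau] increased. *)
Lemma transfer_fixpoint x0 : (forall v, 0 <= x0 v) -> (exists v, 0 < x0 v) ->
  (forall v, x0 v <= transfer 0 x0 v) -> (exists v, x0 v < transfer 0 x0 v) ->
  exists2 tau, 0 < tau &
    exists2 x, (forall v, 0 < x v) & forall v, transfer tau x v = x v.
Proof.
move=> x0ge x0pos x0F x0lt.
have [m m0 mP] := fin_lower_bound w_gt0.
(* At the largest entry of [x] the inequality [x <= F x] forces
   [1 <= (\sum_e c e) * expR (- (tau * m))], hence [tau <= B]. *)
pose B := (\sum_e c e) / m.
pose K : set (R * vec R V) :=
  [set p | 0 <= p.1 <= B /\ forall v, 0 <= coord p.2 v <= 1] `&`
  [set p | \sum_v coord p.2 v = 1] `&`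
  \bigcap_(v in setT) [set p | 0 <= transfer p.1 (coord p.2) v - coord p.2 v].
have cK : compact K.
  apply: compact_closedI; last first.
    apply: closed_bigI => v _.
    apply: (@preimage_closed _ _
      (fun p : R * vec R V => transfer p.1 (coord p.2) v - coord p.2 v)
      [set y | 0 <= y]); last exact: closed_ge.
    move=> p _.
    exact: (@continuous_sub R (R * vec R V)%type
      (fun p => transfer p.1 (coord p.2) v) (fun p => coord p.2 v)
      (@transfer_continuous v) (@coord_continuous R V v)).
  apply: compact_closedI; first exact: box_compact.
  apply: (@preimage_closed _ _
    (fun p : R * vec R V => \sum_v coord p.2 v) [set y | y = 1]).
    move=> p _.
    apply: (@continuous_fsum R (R * vec R V)%type V xpredT
      (fun v p => coord p.2 v)) => v _.
    exact: coord_continuous.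
  exact: closed_eq.
have inK tau x : 0 <= tau -> (forall v, 0 <= x v) -> (exists v, 0 < x v) ->
    (forall v, x v <= transfer tau x v) ->
    exists2 y : V -> R, K (tau, y) & forall v, y v = (\sum_u x u)^-1 * x v.
  move=> tau0 xge [u xu] xF.
  have S0 : 0 < \sum_v x v.
    by rewrite (bigD1 u) //= ltr_pwDl // sumr_ge0.
  pose y v := (\sum_u x u)^-1 * x v.
  have yF v : y v <= transfer tau y v by rewrite transferZ ler_pM2l ?invr_gt0.
  have yge v : 0 <= y v by rewrite mulr_ge0 // invr_ge0 ltW.
  have ysum : \sum_v y v = 1 by rewrite -mulr_sumr mulVf // gt_eqF.
  exists y => //; split; [split=> //; split|] => /=.
  - have ygt : 0 < y u by rewrite mulr_gt0 // invr_gt0.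
    have [v yv] : exists v, forall u, y u <= y v.
      by exists [arg max_(v > u) y v]%O; case: arg_maxP => // v _ H z; exact: H.
    have {ygt} ygt : 0 < y v by apply: lt_le_trans ygt (yv u).
    have le1 : 1 <= (\sum_e c e) * expR (- (tau * m)).
      rewrite -(ler_pM2r ygt) mul1r; apply: le_trans (yF v) _.
      rewrite mulr_suml mulr_suml [X in _ <= X](bigID (fun e => src e == v)) /=.
      rewrite -[X in X <= _]addr0; apply: lerD.
        apply: ler_sum => e _; rewrite -!mulrA ler_pM2l //.
        apply: ler_pM; [exact: expR_ge0 | exact: yge | | exact: yv].
        by rewrite ler_expR lerN2 ler_wpM2l.
      apply: sumr_ge0 => e _; rewrite mulr_ge0 // mulr_ge0 ?expR_ge0 //.
      exact: ltW.
    rewrite tau0 /= ler_pdivlMr //.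
    have := expR_ge1Dx (tau * m); move: le1.
    rewrite expRN ler_pdivlMr ?expR_gt0 //.
    by set e1 := expR _; lra.
  - move=> v; rewrite yge /= -[leRHS]ysum (bigD1 v) //= lerDl.
    exact: sumr_ge0.
  - by move=> v _ /=; rewrite subr_ge0.
have bump tau x : 0 <= tau -> (forall v, 0 <= x v) ->
    (forall v, x v <= transfer tau x v) -> (exists v, x v < transfer tau x v) ->
    exists2 d, 0 < d & exists y, K (tau + d, y).
  move=> tau0 xge xF xlt.
  have [y [yge yF]] := transfer_make_strict xge xF xlt.
  have [d d0 yd] := transfer_strict_shift yge yF.
  exists d => //; have [u _] := x0pos.
  have [||z Kz _] := inK (tau + d) y _ yge _ yd; last by exists z.
    by rewrite addr_ge0 // ltW.
  have [e se] : exists e, src e = u.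
    have : transfer tau y u != 0 by rewrite gt_eqF // (le_lt_trans (yge u)).
    rewrite /transfer; case: (pickP (fun e => src e == u)) => [e /eqP|noe].
      by exists e.
    by rewrite big_pred0 ?eqxx.
  apply/not_existsP => y0.
  have y0' v : y v = 0.
    by apply/eqP; rewrite eq_le yge andbT leNgt; apply/negP/y0.
  have := yF u; rewrite /transfer big1 ?y0' ?ltxx // => d' _.
  by rewrite y0' mulr0.
have [d0 d0gt [y0 Ky0]] := bump 0 x0 (lexx 0) x0ge x0F x0lt.
have [p pK pmax] : exists2 p, p \in K & forall q, q \in K -> q.1 <= p.1.
  apply: (@compact_EVT_max (R * vec R V)%type R fst K) => //.
    by exists (0 + d0, y0).
  by apply: continuous_subspaceT => q; exact: cvg_fst.
have pgt : 0 < p.1.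
  by apply: lt_le_trans (pmax _ (mem_set Ky0)); rewrite /= add0r.
have [[[_ p1] psum] pF] := set_mem pK.
have xge v : 0 <= coord p.2 v by have /andP[] := p1 v.
have xF v : coord p.2 v <= transfer p.1 (coord p.2) v.
  by have := pF v I; rewrite /= subr_ge0.
have xpos : exists v, 0 < coord p.2 v.
  apply/not_existsP => xn; have := psum; rewrite /= big1 => [/eqP|v _].
    by rewrite eq_sym oner_eq0.
  by apply/eqP; rewrite eq_le xge andbT leNgt; apply/negP/xn.
have xE v : transfer p.1 (coord p.2) v = coord p.2 v.
  apply/eqP; rewrite eq_le xF andbT leNgt; apply/negP => xlt.
  have [d dgt [y Ky]] := bump _ _ (ltW pgt) xge xF (ex_intro _ v xlt).
  by have := pmax _ (mem_set Ky); rewrite /= leNgt ltrDl dgt.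
exists p.1 => //; exists (coord p.2) => //.
exact: transfer_fix_gt0 xpos xE.
Qed.
End Transfer.

(** * Spectral radius of a nonnegative matrix *)

Section SpectralRadius.
Variables (R : realType) (n : nat) (A : 'M[R]_n) (x : 'I_n -> R).
Hypothesis A_ge0 : forall i j, 0 <= A i j.
Hypothesis x_gt0 : forall i, 0 < x i.

Local Notation normc := (@Normc.normc R).

Lemma normc_sum (I : finType) (F : I -> R[i]) :
  normc (\sum_i F i) <= \sum_i normc (F i).
Proof.
elim/big_ind2: _ => // [|a b c d ab cd].
  by rewrite Normc.normc0.
by apply: le_trans (le_normcD _ _) _; rewrite lerD.
Qed.

Lemma normc_real (a : R) : 0 <= a -> normc (real_complex R a) = a.
Proof.
by move=> a0; rewrite /= expr0n addr0 sqrtr_sqr ger0_norm.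
Qed.

Lemma normc_ge0 z : 0 <= normc z.
Proof. by case: z => a b; exact: sqrtr_ge0. Qed.

(** For an eigenvector [v], compare both sides of the eigenvalue equation at the
    entry where [|v_i| / x_i] is largest. *)
Lemma eigenvalue_le theta z :
  (forall j, \sum_i x i * A i j <= theta * x j) ->
  eigenvalue (map_mx (real_complex R) A) z -> normc z <= theta.
Proof.
move=> xA /eigenvalueP[v vA v0].
have [j0 vj0] : exists j, v 0 j != 0.
  by apply/existsP; apply: contra_neqT v0; rewrite negb_exists => /forallP v0;
     apply/rowP => j; rewrite mxE; apply/eqP; have := v0 j; rewrite negbK.
pose q i := normc (v 0 i) / x i.
have [j qj] : exists j, forall i, q i <= q j.
  by exists [arg max_(i > j0) q i]%O; case: arg_maxP => // j _ H i; exact: H.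
have q0 : 0 < q j.
  apply: lt_le_trans (qj j0); rewrite divr_gt0 // lt_neqAle normc_ge0 andbT.
  by apply: contra_neq vj0 => /esym/Normc.eq0_normc.
have vle i : normc (v 0 i) <= q j * x i by rewrite -ler_pdivrMr //; exact: qj.
have : normc z * normc (v 0 j) <= q j * (theta * x j).
  rewrite -Normc.normcM.
  have -> : z * v 0 j = \sum_i v 0 i * real_complex R (A i j).
    have := congr1 (fun u : 'rV_n => u 0 j) vA; rewrite !mxE => <-.
    by apply: eq_bigr => i _; rewrite mxE.
  apply: le_trans (normc_sum _) _.
  apply: le_trans (_ : _ <= q j * (\sum_i x i * A i j)) _; last by rewrite ler_pM2l.
  rewrite mulr_sumr; apply: ler_sum => i _.
  by rewrite Normc.normcM normc_real // mulrA ler_wpM2r.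
have -> : normc (v 0 j) = q j * x j by rewrite /q divfK // gt_eqF.
by rewrite mulrCA ler_pM2l // ler_pM2r.
Qed.

Lemma spectral_radius_le theta : 0 <= theta ->
  (forall j, \sum_i x i * A i j <= theta * x j) -> spectral_radius A <= theta.
Proof.
move=> t0 xA; rewrite /spectral_radius.
set S := [set _ | _ in _].
have [-> |/set0P S0] := eqVneq S set0; first by rewrite sup0.
by apply: ge_sup => // _ [z /= zA <-]; exact: eigenvalue_le zA.
Qed.

Lemma spectral_radius_eq theta : (0 < n)%N -> 0 <= theta ->
  (forall j, \sum_i x i * A i j = theta * x j) -> spectral_radius A = theta.
Proof.
move=> n0 t0 xA; apply/eqP; rewrite eq_le spectral_radius_le //=; last first.
  by move=> j; rewrite xA.
apply: ub_le_sup.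
  exists theta => _ [z /= zA <-].
  by apply: eigenvalue_le zA => j; rewrite xA.
exists (real_complex R theta); last exact: normc_real.
apply/eigenvalueP; exists (\row_i real_complex R (x i)).
  apply/rowP => j; rewrite !mxE -rmorphM -xA rmorph_sum.
  by apply: eq_bigr => i _; rewrite !mxE rmorphM.
apply/eqP => /rowP/(_ (Ordinal n0)); rewrite !mxE.
move=> /(congr1 (@complex.Re R)) /= x0.
by have := x_gt0 (Ordinal n0); rewrite x0 ltxx.
Qed.

End SpectralRadius.

Definition path_transfer (R : realType) (G : wgraph R) : R ->
    (vertex G -> R) -> vertex G -> R :=
  transfer (@src R G) (@dst R G) (fun=> 1) wt.

Section PathTransfer.
Variables (R : realType) (G : wgraph R).
Implicit Types (h : R) (x : vertex G -> R).

Lemma path_transferE h x v : path_transfer h x v =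
  \sum_(e : edge G | src e == v) expR (- (h * wt e)) * x (dst e).
Proof. by apply: eq_bigr => e _; rewrite mul1r. Qed.

Lemma wt_lower_bound : exists2 m : R, 0 < m & forall e : edge G, m <= wt e.
Proof. by apply: fin_lower_bound => e; exact: wt_gt0. Qed.

Lemma path_transfer_contract h h' m x v : h <= h' ->
  (forall e : edge G, m <= wt e) -> (forall v, 0 <= x v) ->
  path_transfer h' x v <= expR (- ((h' - h) * m)) * path_transfer h x v.
Proof.
move=> hh' mP x0; rewrite !path_transferE mulr_sumr; apply: ler_sum => e _.
rewrite mulrA -expRD ler_wpM2r // ler_expR.
have : (h' - h) * m <= (h' - h) * wt e by rewrite ler_wpM2l // subr_ge0.
by lra.
Qed.

Lemma path_transfer_lt h h' x v : h' < h -> (forall v, 0 < x v) ->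
  path_transfer h x v = x v -> x v < path_transfer h' x v.
Proof.
move=> hh' x0 xE.
have [m m0 mP] := wt_lower_bound.
have le1 := path_transfer_contract v (ltW hh') mP (fun v => ltW (x0 v)).
rewrite xE in le1; apply: le_lt_trans le1 _; rewrite gtr_pMl.
  by rewrite -expR0 ltr_expR oppr_lt0 mulr_gt0 // subr_gt0.
have [e /eqP se|noe] := pickP (fun e : edge G => src e == v).
  rewrite path_transferE (bigD1 e) ?se //= ltr_pwDl ?mulr_gt0 ?expR_gt0 //.
  by apply: sumr_ge0 => d _; rewrite mulr_ge0 ?expR_ge0 // ltW.
by have := x0 v; rewrite -xE path_transferE big_pred0 // ltxx.
Qed.

Definition irreducible_graph := forall P : pred (vertex G), (exists v, P v) ->
  (forall e : edge G, P (dst e) -> P (src e)) -> forall v, P v.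

Lemma strongly_connected_irreducible :
  strongly_connected G -> irreducible_graph.
Proof.
move=> sG P [u Pu] PE v; have /asboolP[[x]] := sG v u.
rewrite /path_between; case: x => // e x /and3P[/eqP <- + + _].
elim: x e => [|d x IH] e /=.
  by move=> _ /eqP du; apply: PE; rewrite du.
case/andP=> /eqP sd px lx; apply: PE; rewrite -sd; exact: IH.
Qed.

End PathTransfer.

(** * The growth exponent of a strongly connected graph *)

Definition simple_graph (R : realType) (H : wgraph R) :=
  forall e f : edge H, src e = src f -> dst e = dst f -> e = f.

Section ExpMatrix.
Variables (R : realType) (H : wgraph R).
Hypothesis H_simple : simple_graph H.

Lemma exp_matrix_ge0 (s : R) i j : 0 <= @exp_matrix R H s i j.
Proof. by rewrite mxE; case: pickP => // e _; exact: expR_ge0. Qed.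

(** In a simple graph the row vector [x] times the matrix collects, for each
    vertex, the edges leaving it. *)
Lemma exp_matrix_transfer s (x : vertex H -> R) j :
  \sum_i x (enum_val i) * @exp_matrix R H s i j =
  path_transfer s^-1 x (enum_val j).
Proof.
rewrite path_transferE (partition_big dst xpredT) //= (big_enum_val (A := vertex H)) /=.
apply: eq_bigr => i _; rewrite mxE; case: pickP => [e|noe].
  rewrite inE => /andP[/eqP se /eqP de].
  rewrite (big_pred1 e) => [|f]; last first.
    apply/andP/eqP => [[/eqP sf /eqP df]|->]; last by rewrite se de.
    by apply: H_simple; rewrite ?se ?de.
  by rewrite de mulrC; congr (expR _ * _); rewrite mulNr mulrC.
rewrite mulr0 big_pred0 // => e; have := noe e; by rewrite inE.
Qed.

(** At an exponent above [h] the vector [x] is strictly contracted, so all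
    eigenvalues are below [1]; at an exponent below [h] it is strictly expanded,
    and the fixed point theorem with all edge weights replaced by [1] yields an
    eigenvalue [expR tau] with [tau > 0]. *)
Lemma spectral_radius1_unique (h : R) (x : vertex H -> R) :
  irreducible_graph H -> (exists v : vertex H, True) ->
  0 < h -> (forall v, 0 < x v) -> (forall v, path_transfer h x v = x v) ->
  forall s, 0 < s -> (spectral_radius (exp_matrix H s) = 1 <-> s = h^-1).
Proof.
move=> irr [v0 _] h0 x0 xE s s0.
have n0 : (0 < #|vertex H|)%N by apply/card_gt0P; exists v0.
have xe0 (i : 'I_#|vertex H|) : 0 < x (enum_val i) by exact: x0.
have [m m0 mP] := wt_lower_bound H.
have contract (u u' : R) v (uu' : u <= u') :=
  path_transfer_contract v uu' mP (fun v => ltW (x0 v)).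
split=> [sp1|->]; last first.
  apply: (spectral_radius_eq (@exp_matrix_ge0 _) xe0 n0 ler01) => j.
  by rewrite exp_matrix_transfer invrK xE mul1r.
suff <- : s^-1 = h by rewrite invrK.
have [hs|hs|//] := ltgtP h s^-1.
  have th1 : expR (- ((s^-1 - h) * m)) < 1.
    by rewrite -expR0 ltr_expR oppr_lt0 mulr_gt0 // subr_gt0.
  have : spectral_radius (exp_matrix H s) <= expR (- ((s^-1 - h) * m)).
    apply: (spectral_radius_le (@exp_matrix_ge0 _) xe0 (expR_ge0 _)) => j.
    rewrite exp_matrix_transfer; apply: le_trans (contract _ _ _ (ltW hs)) _.
    by rewrite xE.
  by rewrite sp1 leNgt th1.
pose c (e : edge H) := expR (- (s^-1 * wt e)).
have F0 y v : transfer src dst c (fun=> 1) 0 y v = path_transfer s^-1 y v.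
  by rewrite path_transferE; apply: eq_bigr => e _; rewrite mul0r oppr0 expR0 mulr1.
have lt v := path_transfer_lt hs x0 (xE v).
have [||||||tau tau0 [y y0 yE]] :=
  @transfer_fixpoint R _ _ (@src R H) (@dst R H) c (fun=> 1) _ _ irr x.
- by move=> e; exact: expR_gt0.
- by [].
- by move=> v; exact: ltW.
- by exists v0.
- by move=> v; rewrite F0 ltW.
- by exists v0; rewrite F0.
have yE' v : path_transfer s^-1 y v = expR tau * y v.
  rewrite -[in RHS]yE mulr_sumr path_transferE; apply: eq_bigr => e _.
  have tauV : expR tau * expR (- (tau * 1)) = 1 by rewrite mulr1 -expRD subrr expR0.
  rewrite -mulrA mulrCA; congr (_ * _).
  by rewrite mulrA tauV mul1r.
have : spectral_radius (exp_matrix H s) = expR tau.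
  apply: (@spectral_radius_eq _ _ _ (fun i => y (enum_val i))
    (@exp_matrix_ge0 _) _ _ n0 (expR_ge0 _)) => [//|j].
  by rewrite exp_matrix_transfer yE'.
rewrite sp1 => e1; have := tau0; rewrite -expR_gt1 -e1 ltxx //.
Qed.

End ExpMatrix.

Section Subdivision.
Variables (R : realType) (D : wgraph R).
Local Notation H := (subdivision D).

Lemma subdivision_simple : simple_graph H.
Proof.
move=> [e|[e b]] [f|[f d]] //=.
- move=> [se] [de]; congr inl; apply: val_inj => /=.
  apply/eqP; apply/negPn/negP => ef.
  have := valP e; rewrite /parallel -leqNgt => /card_le1_eqP/(_ (val e) (val f)).
  rewrite !inE !eqxx se de !eqxx => /(_ isT isT) efE.
  by move: ef; rewrite efE eqxx.
- by case: d.
- by case: b.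
- by case: b; case: d => //=; [move=> [->] _ | move=> _ [->]].
Qed.

Lemma subdivision_irreducible : irreducible_graph D -> irreducible_graph H.
Proof.
move=> irr P [v Pv] PE.
have Pl : forall u, P (inl u).
  apply: (@irr (fun u => P (inl u))).
    case: v Pv => [u|e] Pv; first by exists u.
    by exists (src (val e)); exact: (PE (inr (e, false))).
  move=> e Pe; have [pe|npe] := boolP (parallel e).
    pose e' : {e : edge D | parallel e} := exist _ e pe.
    apply: (PE (inr (e', false))); exact: (PE (inr (e', true))).
  by apply: (PE (inl (exist _ e npe))).
by case=> [u|e]; [exact: Pl | exact: (PE (inr (e, true)) (Pl _))].
Qed.

(** At the new vertex in the middle of [e] the equation has a single term, which
    determines the value. *)
Definition subdiv_vector (h : R) (x : vertex D -> R) (v : vertex H) : R :=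
  match v with
  | inl u => x u
  | inr e => expR (- (h * (wt (val e) / 2))) * x (dst (val e))
  end.

Lemma subdiv_transfer h x : (forall v, path_transfer h x v = x v) ->
  forall v, path_transfer h (subdiv_vector h x) v = subdiv_vector h x v.
Proof.
move=> xE.
have half (a : R) :
    expR (- (h * (a / 2))) * expR (- (h * (a / 2))) = expR (- (h * a)).
  by rewrite -expRD; congr expR; lra.
pose F e := expR (- (h * wt e)) * x (dst e).
have sub (P Q : pred (edge D)) :
    \sum_(e : {e : edge D | P e} | Q (val e)) F (val e) =
    \sum_(e | P e && Q e) F e.
  by rewrite (@big_sub_cond _ _ _ _ P Q).
move=> [u|e]; rewrite path_transferE big_sumType /=.
  rewrite -[RHS]xE path_transferE [RHS](bigID (fun e => ~~ parallel e)) /=.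
  congr (_ + _).
    rewrite (sub (fun e => ~~ parallel e) (fun e => src e == u)).
    by apply: eq_bigl => e; rewrite andbC.
  have -> : \sum_(e | (src e == u) && ~~ ~~ parallel e) F e =
      \sum_(e : {e : edge D | parallel e} | src (val e) == u) F (val e).
    rewrite (sub (@parallel R D) (fun e => src e == u)).
    by apply: eq_bigl => e; rewrite andbC negbK.
  rewrite [RHS](reindex_onto fst (fun e => (e, false))) //=.
  apply: eq_big => [[e b]|[e b]] /=.
    by case: b; rewrite /= xpair_eqE eqxx /= ?andbF ?andbT.
  by case: b => //= _; rewrite mulrA half.
rewrite big_pred0 ?add0r // (big_pred1 (e, true)) //= => -[f []] //=.
  by apply/eqP/eqP => [[->]|[->]].
by rewrite xpair_eqE andbF.
Qed.

End Subdivision.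

Section EntropyOfComponent.
Variables (R : realType) (D : wgraph R).

(** The fixed vector of [D] extends to the subdivided graph, which is simple and
    irreducible, and there [h] is determined by the spectral radius. *)
Lemma s_value_unique (h : R) (x : vertex D -> R) :
  irreducible_graph D -> (exists v : vertex D, True) ->
  0 < h -> (forall v, 0 < x v) -> (forall v, path_transfer h x v = x v) ->
  s_value D = h^-1.
Proof.
move=> irr [v0 _] h0 x0 xE.
have uniq := spectral_radius1_unique (@subdivision_simple R D)
  (subdivision_irreducible irr) (ex_intro _ (inl v0) I) h0 _ (subdiv_transfer xE).
have {}uniq := uniq _.
rewrite /s_value; set S := [set s | _].
have Sh : S h^-1.
  split; first by rewrite invr_gt0.
  apply/uniq => //; last by rewrite invr_gt0.
  by case=> [u|e] /=; rewrite ?mulr_gt0 ?expR_gt0.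
have [s0 /uniq] := getPex (ex_intro S _ Sh); apply => //.
by case=> [u|e] /=; rewrite ?mulr_gt0 ?expR_gt0.
Qed.

Hypothesis sD : strongly_connected D.

Lemma strongly_connected_out v : exists e : edge D, src e = v.
Proof.
have /asboolP[[[|e x] //]] := sD v v; rewrite /path_between.
by case/and3P => /eqP <- _ _ _; exists e.
Qed.

Lemma strongly_connected_in v : exists e : edge D, dst e = v.
Proof.
have /asboolP[[[|e x] //]] := sD v v; rewrite /path_between.
by case/and3P => _ _ /eqP <- _; exists (last e x).
Qed.

(** In-degrees are positive and have the same sum as the out-degrees. *)
Lemma out_degree1_cycle :
  (forall v, #|[set e : edge D | src e == v]%SET| = 1%N) -> is_cycle D.
Proof.
move=> out1; split=> // v; split => //.
have in_gt0 u : (0 < #|[set e : edge D | dst e == u]%SET|)%N.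
  have [e <-] := strongly_connected_in u.
  by apply/card_gt0P; exists e; rewrite inE.
have sum1 (f : edge D -> vertex D) :
    (\sum_u #|[set e : edge D | f e == u]%SET| = #|edge D|)%N.
  rewrite -sum1_card (partition_big f xpredT) //=; apply: eq_bigr => u _.
  by rewrite -sum1_card; apply: eq_bigl => e; rewrite inE.
have := sum1 dst; rewrite -(sum1 src).
rewrite [RHS](eq_bigr (fun=> 1%N)) // (bigD1 v) //= [RHS](bigD1 v) //=.
have : (\sum_(u | u != v) 1 <=
  \sum_(u | u != v) #|[set e : edge D | dst e == u]%SET|)%N.
  by apply: leq_sum => u _; exact: in_gt0.
have := in_gt0 v; lia.
Qed.

(** At exponent [0] the constant vector [1] is mapped to the out-degrees, which
    are positive and not all equal to [1]. *)
Lemma not_cycle_fixpoint : (exists v : vertex D, True) -> ~ is_cycle D ->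
  exists2 h : R, 0 < h & exists2 x : vertex D -> R, (forall v, 0 < x v) &
    forall v, path_transfer h x v = x v.
Proof.
move=> [v0 _] ncyc.
have F0 v : path_transfer 0 (fun=> 1 : R) v =
    #|[set e : edge D | src e == v]%SET|%:R.
  rewrite path_transferE -sum1_card natr_sum; apply: eq_big => [e|e _].
    by rewrite inE.
  by rewrite mul0r oppr0 expR0 mulr1.
have out_gt0 u : (0 < #|[set e : edge D | src e == u]%SET|)%N.
  have [e <-] := strongly_connected_out u.
  by apply/card_gt0P; exists e; rewrite inE.
apply: (@transfer_fixpoint R _ _ _ _ (fun=> 1) wt _ _ _ (fun=> 1)) => //.
- exact: wt_gt0.
- exact: strongly_connected_irreducible.
- by move=> v; move: (F0 v); rewrite /path_transfer => ->; rewrite ler1n.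
- apply/not_existsP => noe; apply: ncyc; apply: out_degree1_cycle => v.
  move: (noe v) (F0 v); rewrite /path_transfer => + vE; rewrite vE ltr1n => /negP.
  by have := out_gt0 v; lia.
Qed.

End EntropyOfComponent.

(** * Walks and strongly connected components *)

Section Walks.
Variables (R : realType) (G : wgraph R).
Implicit Types (u v z : vertex G) (x y : seq (edge G)).

(** Walks may be empty, unlike paths; this makes concatenation and the recursion
    on the first edge uniform. *)
Fixpoint walk u v x : bool :=
  if x is e :: x' then (src e == u) && walk (dst e) v x' else u == v.

Lemma path_betweenE u v x : path_between u v x = (x != [::]) && walk u v x.
Proof.
case: x => //= e x; congr (_ && _).
elim: x e => //= d x IH e; rewrite -IH eq_sym -andbA; congr (_ && _).
Qed.

Lemma walk_cat u v x y : walk u v (x ++ y) =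
  walk u (last u (map dst x)) x && walk (last u (map dst x)) v y.
Proof.
elim: x u => [|e x IH] u /=; first by rewrite eqxx.
by rewrite IH andbA.
Qed.

Lemma walk_last u v x : walk u v x -> last u (map dst x) = v.
Proof. by elim: x u => [|e x IH] u /= => [/eqP|/andP[_ /IH]]. Qed.

Lemma walk_trans u v z x y : walk u v x -> walk v z y -> walk u z (x ++ y).
Proof. by move=> ux vy; rewrite walk_cat (walk_last ux) ux. Qed.

Lemma vertex_listE u v x : walk u v x -> x != [::] ->
  vertex_list x = u :: map dst x.
Proof.
case: x => //= e x /andP[/eqP <- ex] _; congr cons.
elim: x e ex => //= d x IH e /andP[/eqP -> dx]; congr cons; exact: IH.
Qed.

Lemma walk_splitP u v z x : walk u v x ->
  reflect (exists y1 y2, [/\ x = y1 ++ y2, walk u z y1 & walk z v y2])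
          (z \in u :: map dst x).
Proof.
move=> ux; apply: (iffP idP).
  elim: x u ux => [|e x IH] u /=.
    by rewrite inE => /eqP <- /eqP ->; exists [::], [::]; rewrite /= eqxx.
  case/andP=> /eqP su ex; rewrite inE => /predU1P[->|zx].
    by exists [::], (e :: x); rewrite /= eqxx su eqxx ex.
  have [y1 [y2 [-> ey1 zy2]]] := IH _ ex zx.
  by exists (e :: y1), y2; rewrite /= su eqxx ey1.
move=> [y1 [y2 [-> uy1 _]]]; rewrite -(walk_last uy1) map_cat.
by rewrite -cat_cons mem_cat mem_last.
Qed.

Definition access u v : Prop := exists x, walk u v x.

Lemma access_refl u : access u u.
Proof. by exists [::]; rewrite /= eqxx. Qed.

Lemma access_trans u v z : access u v -> access v z -> access u z.
Proof. by move=> [x ux] [y vy]; exists (x ++ y); exact: walk_trans ux vy. Qed.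

Lemma access_edge (e : edge G) : access (src e) (dst e).
Proof. by exists [:: e]; rewrite /= !eqxx. Qed.

Lemma reaches_access u v : reaches u v -> access u v.
Proof. by move=> [x]; rewrite path_betweenE => /andP[_]; exists x. Qed.

Lemma access_reaches u v : access u v -> u = v \/ reaches u v.
Proof.
move=> [[|e x]]; first by move=> /eqP; left.
by move=> ex; right; exists (e :: x); rewrite path_betweenE.
Qed.

Lemma reaches_edge (e : edge G) : reaches (src e) (dst e).
Proof. by exists [:: e]; rewrite path_betweenE /= !eqxx. Qed.

Lemma reaches_trans u v z : reaches u v -> access v z -> reaches u z.
Proof.
move=> [x]; rewrite path_betweenE => /andP[x0 ux] [y vy].
exists (x ++ y); rewrite path_betweenE (walk_trans ux vy) andbT.
by case: (x) x0.
Qed.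

Lemma mutualP u v : reflect (reaches u v /\ reaches v u) (mutual u v).
Proof. exact: asboolP. Qed.

Lemma mutual_sym u v : mutual u v = mutual v u.
Proof. by apply/mutualP/mutualP => -[]. Qed.

Lemma mutual_trans u v z : mutual u v -> mutual v z -> mutual u z.
Proof.
move=> /mutualP[uv vu] /mutualP[vz zv]; apply/mutualP; split.
  exact: reaches_trans uv (reaches_access vz).
exact: reaches_trans zv (reaches_access vu).
Qed.

Lemma mutual_refl u v : mutual u v -> mutual u u.
Proof. by move=> uv; apply: mutual_trans (uv) _; rewrite mutual_sym. Qed.

Lemma mutual_access u v : mutual u v -> access u v.
Proof. by move=> /mutualP[/reaches_access]. Qed.

Lemma access_mutual u v : reaches u v -> access v u -> mutual u v.
Proof.
move=> uv vu; apply/mutualP; split=> //.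
by have [e|//] := access_reaches vu; move: uv; rewrite e.
Qed.

Lemma mem_scc u v : (v \in scc_of u) = mutual u v.
Proof. by rewrite inE. Qed.

Lemma scc_of_eq u v : mutual u v -> scc_of u = scc_of v.
Proof.
move=> uv; apply/setP => z; rewrite !mem_scc; apply/idP/idP.
  by apply: mutual_trans; rewrite mutual_sym.
exact: mutual_trans.
Qed.

Lemma scc_of_neq0 u : (scc_of u != finset.set0) = mutual u u.
Proof.
apply/set0Pn/idP => [[v]|uu]; first by rewrite mem_scc => /mutual_refl.
by exists u; rewrite mem_scc.
Qed.

(** The number of vertices accessible from [u] decreases along walks, strictly
    when a walk leaves a strongly connected component. *)
Definition rank u : nat := #|[set v | `[< access u v >]]%SET|.

Lemma rank_le u v : access u v -> (rank v <= rank u)%N.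
Proof.
move=> uv; apply: subset_leq_card; apply/fintype.subsetP => z.
by rewrite !inE => /asboolP vz; apply/asboolP; exact: access_trans uv vz.
Qed.

Lemma rank_lt u v : access u v -> ~ access v u -> (rank v < rank u)%N.
Proof.
move=> uv nvu; apply: proper_card; apply/properP; split.
  apply/fintype.subsetP => z; rewrite !inE => /asboolP vz.
  by apply/asboolP; exact: access_trans uv vz.
exists u; first by rewrite inE; apply/asboolP; exact: access_refl.
by rewrite inE; apply/asboolP.
Qed.

Lemma rank_gt0 u : (0 < rank u)%N.
Proof.
by apply/card_gt0P; exists u; rewrite inE; apply/asboolP; exact: access_refl.
Qed.

Lemma rank_edge_lt (e : edge G) : ~~ mutual (src e) (dst e) ->
  (rank (dst e) < rank (src e))%N.
Proof.
move=> ne; apply: rank_lt; first exact: access_edge.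
by move=> de; move/negP: ne; apply; apply: access_mutual => //; exact: reaches_edge.
Qed.

Lemma path_weight_cons (e : edge G) x : path_weight (e :: x) = wt e + path_weight x.
Proof. by rewrite /path_weight big_cons. Qed.

Lemma path_weight_cat x y : path_weight (x ++ y) = path_weight x + path_weight y.
Proof. by rewrite /path_weight big_cat. Qed.

Lemma path_weight_nil : path_weight ([::] : seq (edge G)) = 0.
Proof. by rewrite /path_weight big_nil. Qed.

Lemma path_weight_ge0 x : 0 <= path_weight x.
Proof. by apply: sumr_ge0 => e _; rewrite ltW // wt_gt0. Qed.

Lemma path_weight_size m x : (forall e : edge G, m <= wt e) ->
  m * (size x)%:R <= path_weight x.
Proof.
move=> mP; elim: x => [|e x IH]; first by rewrite mulr0 path_weight_nil.
rewrite path_weight_cons /= -natr1 mulrDr mulr1; have := mP e; lra.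
Qed.

Lemma finite_weight_le (t : R) :
  finite_set [set x : seq (edge G) | path_weight x <= t].
Proof.
have [m m0 mP] := wt_lower_bound G.
apply: sub_finite_set (finite_seq_size _ (Num.truncn (`|t| / m))) => x /= xt.
rewrite -ltnS -(ltr_nat R); apply: le_lt_trans (truncnS_gt _).
rewrite ler_pdivlMr // mulrC; apply: le_trans (path_weight_size x mP) _.
exact: le_trans xt (ler_norm _).
Qed.

Definition walks u v (t : R) : set (seq (edge G)) :=
  [set x | walk u v x /\ path_weight x <= t].

Lemma finite_walks u v t : finite_set (walks u v t).
Proof. by apply: sub_finite_set (finite_weight_le t) => x []. Qed.

Lemma cnt_walks_rec u v t : cnt (walks u v t) =
  (((u == v) && (0 <= t)%R) +
   \sum_(e : edge G | src e == u) cnt (walks (dst e) v (t - wt e)%R))%N.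
Proof.
rewrite cnt_cons; last exact: finite_walks.
congr (_ + _)%N.
  congr (nat_of_bool _); apply/asboolP/andP; rewrite /walks /= path_weight_nil.
    by case.
  by case.
rewrite [RHS]big_mkcond /=; apply: eq_bigr => e _.
case: eqP => [se|nse]; last first.
  by apply: cnt0; apply/seteqP; split=> // x; rewrite /walks /= => -[/andP[/eqP]].
congr cnt; apply/seteqP; split => x; rewrite /walks /= path_weight_cons.
  by case=> /andP[_ ->] ?; split=> //; lra.
by case=> -> ?; rewrite se eqxx; split=> //; lra.
Qed.

Lemma cnt_walks_lt0 u v t : t < 0 -> cnt (walks u v t) = 0%N.
Proof.
move=> t0; apply: cnt0; apply/seteqP; split=> // x [_ xt].
by have := path_weight_ge0 x; lra.
Qed.

Lemma cnt_walks0 u v t : ~ access u v -> cnt (walks u v t) = 0%N.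
Proof.
move=> nuv; apply: cnt0; apply/seteqP; split=> // x [ux _].
by apply: nuv; exists x.
Qed.

End Walks.

Section Between.
Variables (R : realType) (G : wgraph R) (v1 v2 : vertex G).
Local Notation X := (paths v1 v2).

Lemma VtP u : X !=set0 -> reflect (access v1 u /\ access u v2) (u \in Vt X).
Proof.
move=> X0; rewrite inE; apply: (iffP (asboolP _)).
  move=> [x]; rewrite /paths /= path_betweenE => /andP[x_n0 wx].
  rewrite (vertex_listE wx x_n0) => /(walk_splitP _ wx)[y1 [y2 [_ ? ?]]].
  by split; [exists y1|exists y2].
have [x0 Xx0] := X0; move=> [[y1 w1] [y2 w2]].
have w := walk_trans w1 w2.
have [e|yn0] := eqVneq (y1 ++ y2) [::].
  have : y1 = [::] by case: (y1) e.
  move=> y10; move: w1; rewrite y10 => /= /eqP <-.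
  exists x0 => //; move: Xx0; rewrite /paths /= path_betweenE => /andP[x_n0 wx].
  by rewrite (vertex_listE wx x_n0) mem_head.
exists (y1 ++ y2); first by rewrite /paths /= path_betweenE yn0.
by rewrite (vertex_listE w yn0); apply/(walk_splitP _ w); exists y1, y2.
Qed.

End Between.

Section Components.
Variables (R : realType) (G : wgraph R).
Implicit Types (u v : vertex G).

Definition convex (U : {set vertex G}) := forall u v w,
  u \in U -> v \in U -> access u w -> access w v -> w \in U.

Lemma convex_Vt v1 v2 : paths v1 v2 !=set0 -> convex (Vt (paths v1 v2)).
Proof.
move=> X0 u v w /(VtP _ X0)[? _] /(VtP _ X0)[_ ?] uw wv.
apply/(VtP _ X0); split; [exact: access_trans uw|exact: access_trans wv _].
Qed.

Lemma convex_scc u : convex (scc_of u).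
Proof.
move=> a b w; rewrite !mem_scc => ua ub aw wb.
have wu : access w u.
  by apply: access_trans wb _; rewrite mutual_sym in ub; exact: mutual_access.
apply: access_mutual => //.
by have /mutualP[ua' _] := ua; exact: reaches_trans ua' aw.
Qed.

Section Induced.
Variable U : {set vertex G}.
Hypothesis U_convex : convex U.
Local Notation GU := (induced U).
Implicit Types a b : vertex GU.

Lemma induced_walk a b (x : seq (edge GU)) :
  walk a b x = walk (val a) (val b) (map val x).
Proof. by elim: x a => [|e x IH] a //=; rewrite IH. Qed.

Lemma walk_induced a b (x : seq (edge G)) : walk (val a) (val b) x ->
  exists y : seq (edge GU), walk a b y /\ map val y = x.
Proof.
elim: x a => [|e x IH] a /=.
  by move=> /eqP ab; exists [::]; rewrite /= (val_inj ab).
case/andP=> /eqP se ex.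
have seU : src e \in U by rewrite se; exact: valP.
have deU : dst e \in U.
  apply: U_convex seU (valP b) (access_edge e) _; by exists x.
have [y [wy yx]] := IH (exist _ (dst e) deU) ex.
have eU : (src e \in U) && (dst e \in U) by rewrite seU deU.
exists (exist _ e eU :: y); rewrite /= yx; split => //.
apply/andP; split; first by apply/eqP/val_inj.
rewrite induced_walk /=; move: wy; rewrite induced_walk => wy; exact: wy.
Qed.

Lemma induced_reaches a b : reaches a b <-> reaches (val a) (val b).
Proof.
split=> [[x]|[x]]; rewrite path_betweenE => /andP[x0 wx].
  exists (map val x); rewrite path_betweenE -induced_walk wx andbT.
  by case: (x) x0.
have [y [wy yx]] := walk_induced wx.
exists y; rewrite path_betweenE wy andbT.
by case: (y) yx => // yx; rewrite -yx in x0.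
Qed.

Lemma induced_mutual a b : mutual a b = mutual (val a) (val b).
Proof. by apply/mutualP/mutualP => -[? ?]; split; apply/induced_reaches. Qed.

(** By convexity the components of an induced graph are components of [G]. *)
Lemma sccs_onP (C : {set vertex G}) : reflect
  (exists u, [/\ u \in U, mutual u u & C = scc_of u]) (C \in sccs_on U).
Proof.
have sccE a : [set val b | b in scc_of a]%SET = scc_of (val a).
  apply/setP => w; rewrite mem_scc; apply/imsetP/idP => [[b ab ->]|aw].
    by rewrite -induced_mutual -mem_scc.
  have wU : w \in U.
    apply: U_convex (valP a) (valP a) (mutual_access aw) _.
    by apply: mutual_access; rewrite mutual_sym.
  exists (exist _ w wU); last by [].
  by rewrite inE induced_mutual.
apply: (iffP imsetP) => [[S /imsetP[a]]|[u [uU uu ->]]].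
  rewrite inE scc_of_neq0 induced_mutual => aa -> ->; rewrite sccE.
  by exists (val a); split => //; exact: valP.
pose a : vertex GU := exist _ u uU.
exists (scc_of a); last by rewrite sccE.
by apply/imsetP; exists a => //; rewrite inE scc_of_neq0 induced_mutual.
Qed.

End Induced.

Lemma induced_scc_strongly_connected u : strongly_connected (induced (scc_of u)).
Proof.
move=> a b; rewrite induced_mutual; last exact: convex_scc.
have := valP a; have := valP b; rewrite !mem_scc => ub ua.
by apply: mutual_trans ub; rewrite mutual_sym.
Qed.

(** The constant outside [U] keeps positive vectors positive. *)
Definition extend (U : {set vertex G}) (x : vertex (induced U) -> R) v : R :=
  if insub v is Some a then x a else 1.

Lemma extend_gt0 (U : {set vertex G}) (x : vertex (induced U) -> R) v :
  (forall a, 0 < x a) -> 0 < extend x v.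
Proof. by rewrite /extend; case: insub. Qed.

Lemma extend_transfer (U : {set vertex G}) (x : vertex (induced U) -> R) h a :
  \sum_(e : edge G | (src e == val a) && (dst e \in U))
    expR (- (h * wt e)) * extend x (dst e) = path_transfer h x a.
Proof.
rewrite path_transferE.
pose F (e : edge G) := expR (- (h * wt e)) * extend x (dst e).
rewrite (eq_bigr (fun e : edge (induced U) => F (val e))); last first.
  move=> e _; rewrite /F /extend /=; congr (_ * _).
  have dU : dst (val e) \in U by have /andP[] := valP e.
  by rewrite insubT; congr x; apply: val_inj.
rewrite -(@big_sub_cond _ _ _ _
  (fun e : edge G => (src e \in U) && (dst e \in U)) (fun e => src e == val a)).
apply: eq_bigl => e.
have -> : (e \in (fun e => (src e \in U) && (dst e \in U))) =
  (src e \in U) && (dst e \in U) by [].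
by case: eqP => [->|]; rewrite ?andbF // (valP a) andbT.
Qed.

End Components.

(** * Exponential bounds for the number of walks *)

Lemma real_step_ind (R : realType) (m t0 : R) (P : R -> Prop) : 0 < m ->
  (forall t, t < t0 -> P t) ->
  (forall t, t0 <= t -> (forall t', t' <= t - m -> P t') -> P t) ->
  forall t, P t.
Proof.
move=> m0 Pt0 Pstep.
have H n : forall t, t < t0 + n%:R * m -> P t.
  elim: n => [|n IH] t; first by rewrite mul0r addr0; exact: Pt0.
  rewrite -natr1 mulrDl mul1r => tn.
  have [/Pt0//|t0t] := ltP t t0.
  by apply: Pstep => // t' t't; apply: IH; lra.
move=> t; apply: (H (Num.truncn (`|t - t0| / m)).+1).
rewrite -ltrBlDl -ltr_pdivrMr //; apply: le_lt_trans (truncnS_gt _).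
by rewrite ler_pM2r ?invr_gt0 // ler_norm.
Qed.

Section ExponentialBounds.
Variables (R : realType) (G : wgraph R).
Implicit Types (u v : vertex G) (U : {set vertex G}).

(** [K y u expR (h t)] dominates the recursion: the contraction by [theta] leaves
    room for the term of the empty walk. *)
Lemma walk_count_upper U v2 h theta (y : vertex G -> R) :
  0 <= h -> theta < 1 -> (forall v, 0 < y v) ->
  (forall u, u \in U -> path_transfer h y u <= theta * y u) ->
  (forall e : edge G, src e \in U -> access (dst e) v2 -> dst e \in U) ->
  exists2 K, 0 < K &
    forall u t, u \in U -> (cnt (walks u v2 t))%:R <= K * expR (h * t).
Proof.
move=> h0 th1 y0 yU Uclosed.
have [ym ym0 ymP] := fin_lower_bound y0.
have [yM yM0 yMP] := fin_upper_bound y.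
pose K := ((1 - theta) * ym)^-1.
have K0 : 0 < K by rewrite invr_gt0 mulr_gt0 // subr_gt0.
have [m m0 mP] := wt_lower_bound G.
suff H t : forall u, u \in U -> (cnt (walks u v2 t))%:R <= K * y u * expR (h * t).
  exists (K * yM) => [|u t uU]; first by rewrite mulr_gt0.
  apply: le_trans (H t u uU) _; rewrite ler_pM2r ?expR_gt0 // ler_pM2l //.
move: t; apply: (real_step_ind m0 (t0 := 0)) => [t t0|t t0 IH] u uU.
  by rewrite cnt_walks_lt0 // mulr_ge0 ?expR_ge0 // mulr_ge0 // ltW.
rewrite cnt_walks_rec natrD natr_sum.
have H1 : \sum_(e : edge G | src e == u) (cnt (walks (dst e) v2 (t - wt e)))%:R
    <= K * expR (h * t) * path_transfer h y u.
  rewrite path_transferE mulr_sumr; apply: ler_sum => e /eqP se.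
  have [acc|nacc] := pselect (access (dst e) v2); last first.
    by rewrite cnt_walks0 // !mulr_ge0 ?expR_ge0 // ltW.
  have dU : dst e \in U by apply: Uclosed; rewrite ?se.
  apply: le_trans (IH (t - wt e) _ _ dU) _; first by have := mP e; lra.
  rewrite mulrBr expRD; set a := expR _; set b := expR _.
  by rewrite le_eqVlt; apply/orP; left; apply/eqP; ring.
apply: le_trans (lerD _ H1) (_ : 1 + _ <= _).
  by case: (_ && _); rewrite ?ler01 ?lexx.
have H2 : K * expR (h * t) * path_transfer h y u <= K * expR (h * t) * (theta * y u).
  by rewrite ler_pM2l ?mulr_gt0 ?expR_gt0 // yU.
have H3 : 1 <= K * expR (h * t) * ((1 - theta) * y u).
  have e1 : 1 <= expR (h * t) by rewrite -expR0 ler_expR mulr_ge0.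
  have k1 : 1 <= K * ((1 - theta) * y u).
    rewrite /K -ler_pdivrMl ?invr_gt0 ?mulr_gt0 ?subr_gt0 // invrK mulr1.
    by rewrite ler_pM2l // subr_gt0.
  rewrite mulrAC; apply: le_trans k1 _.
  by rewrite ler_peMr // mulr_ge0 ?mulr_ge0 ?subr_ge0 // ltW.
apply: le_trans (lerD H3 H2) _; rewrite -mulrDr.
by rewrite le_eqVlt; apply/orP; left; apply/eqP; ring.
Qed.

(** Solutions on the components are combined with weights growing so fast with
    the rank that edges between components contribute little. *)
Lemma supersolution U h theta : 0 <= theta < 1 ->
  (forall S : {set vertex G}, exists x : vertex G -> R, (forall v, 0 < x v) /\
     forall u, u \in U -> scc_of u = S ->
       \sum_(e : edge G | (src e == u) && (dst e \in S))
          expR (- (h * wt e)) * x (dst e) <= theta * x u) ->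
  exists2 y : vertex G -> R, (forall v, 0 < y v) &
    exists2 theta', theta' < 1 &
      forall u, u \in U -> path_transfer h y u <= theta' * y u.
Proof.
move=> /andP[th0 th1] /choice[x xS].
have x0 S v : 0 < x S v by case: (xS S).
have xP S := (xS S).2.
pose xi v := x (scc_of v) v.
have xi0 v : 0 < xi v by exact: x0.
have [m m0 mP] := fin_lower_bound xi0.
pose B : R := 1 + \sum_(e : edge G) expR (- (h * wt e)) * xi (dst e).
have B0 : 0 < B.
  by rewrite ltr_pwDl // sumr_ge0 // => e _; rewrite mulr_ge0 ?expR_ge0 // ltW.
have th1' : 0 < 1 - theta by rewrite subr_gt0.
(* Edges leaving a component lower the rank, so they are damped by [1 / kappa];
   [kappa] is such that their total is at most half of the slack [1 - theta]. *)
pose kappa : R := 1 + B / ((1 - theta) / 2 * m).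
have q0 : 0 < B / ((1 - theta) / 2 * m).
  by rewrite divr_gt0 // mulr_gt0 // divr_gt0.
have k1 : 1 <= kappa by rewrite lerDl ltW.
have k0 : 0 < kappa by apply: lt_le_trans k1.
have Bk : B <= kappa * ((1 - theta) / 2 * m).
  by rewrite -ler_pdivrMr ?mulr_gt0 ?divr_gt0 // lerDr.
exists (fun v => kappa ^+ rank v * xi v) => [v|].
  by rewrite mulr_gt0 // exprn_gt0.
exists ((1 + theta) / 2) => [|u uU]; first by lra.
rewrite path_transferE (bigID (fun e => dst e \in scc_of u)) /=.
have kr0 : 0 < kappa ^+ (rank u).-1 by rewrite exprn_gt0.
have krE : kappa ^+ rank u = kappa * kappa ^+ (rank u).-1.
  by rewrite -exprS prednK // rank_gt0.
have inner : \sum_(e : edge G | (src e == u) && (dst e \in scc_of u))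
    expR (- (h * wt e)) * (kappa ^+ rank (dst e) * xi (dst e))
    <= kappa ^+ rank u * (theta * xi u).
  apply: le_trans (_ : _ <= kappa ^+ rank u *
    \sum_(e : edge G | (src e == u) && (dst e \in scc_of u))
      expR (- (h * wt e)) * x (scc_of u) (dst e)) _; last first.
    by rewrite ler_pM2l ?exprn_gt0 //; exact: xP.
  rewrite mulr_sumr; apply: ler_sum => e /andP[/eqP se]; rewrite mem_scc => ud.
  rewrite /xi -(scc_of_eq ud).
  have -> : rank (dst e) = rank u.
    apply/eqP; rewrite eqn_leq; apply/andP; split; apply: rank_le.
      exact: mutual_access.
    by apply: mutual_access; rewrite mutual_sym.
  by rewrite mulrCA.
have outer : \sum_(e : edge G | (src e == u) && (dst e \notin scc_of u))
    expR (- (h * wt e)) * (kappa ^+ rank (dst e) * xi (dst e))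
    <= kappa ^+ (rank u).-1 * B.
  pose out (e : edge G) := (src e == u) && (dst e \notin scc_of u).
  apply: le_trans (_ : _ <= \sum_(e | out e)
    kappa ^+ (rank u).-1 * (expR (- (h * wt e)) * xi (dst e))) _.
    apply: ler_sum => e /andP[/eqP se]; rewrite mem_scc -se => /rank_edge_lt.
    rewrite se => rlt; rewrite mulrCA ler_pM2r ?mulr_gt0 ?expR_gt0 //.
    by rewrite ler_weXn2l // -ltnS prednK // rank_gt0.
  rewrite -mulr_sumr ler_pM2l // /B [X in _ <= 1 + X](bigID out) /=.
  have : 0 <= \sum_(e | ~~ out e) expR (- (h * wt e)) * xi (dst e).
    by apply: sumr_ge0 => e _; rewrite mulr_ge0 ?expR_ge0 // ltW.
  by lra.
have small : kappa ^+ (rank u).-1 * B <=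
    kappa ^+ rank u * ((1 - theta) / 2 * xi u).
  rewrite krE mulrAC [X in _ <= X]mulrC ler_pM2l //.
  by apply: le_trans Bk _; rewrite ler_pM2l // ler_pM2l ?divr_gt0.
apply: le_trans (lerD inner (le_trans outer small)) _.
by rewrite le_eqVlt; apply/orP; left; apply/eqP; field.
Qed.

(** [x u expR (h t)] solves the recursion that keeps only the edges inside
    [C]; for [t] in a bounded interval the comparison holds because each vertex
    of [C] has a walk to [v2]. *)
Lemma walk_count_lower (C : {set vertex G}) v2 h (x : vertex G -> R) :
  0 <= h -> (forall v, 0 < x v) ->
  (forall u, u \in C -> \sum_(e : edge G | (src e == u) && (dst e \in C))
     expR (- (h * wt e)) * x (dst e) = x u) ->
  (forall u, u \in C -> access u v2) ->
  exists2 c, 0 < c & exists t0, forall u t, u \in C -> t0 <= t ->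
    c * expR (h * t) <= (cnt (walks u v2 t))%:R.
Proof.
move=> h0 x0 xC Cv2.
have /choice[f fP] u : exists y, u \in C -> walk u v2 y.
  by have [/Cv2[y]|] := boolP (u \in C); [exists y|exists [::]].
have [t0 t00 t0P] := fin_upper_bound (fun u => path_weight (f u)).
have [M M0 MP] := fin_upper_bound (@wt R G).
have [m m0 mP] := wt_lower_bound G.
have [xm xm0 xmP] := fin_lower_bound x0.
have [xM xM0 xMP] := fin_upper_bound x.
pose c := (xM * expR (h * (t0 + M)))^-1.
have c0 : 0 < c by rewrite invr_gt0 mulr_gt0 // expR_gt0.
exists (c * xm); first by rewrite mulr_gt0.
exists t0.
suff H t : t0 <= t -> forall u, u \in C ->
    c * x u * expR (h * t) <= (cnt (walks u v2 t))%:R.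
  move=> u t uC tt0; apply: le_trans (H t tt0 u uC).
  by rewrite ler_pM2r ?expR_gt0 // ler_pM2l.
move: t.
apply: (real_step_ind m0 (t0 := t0 + M)) => [t tM tt0 u uC|t tM IH tt0 u uC].
  apply: le_trans (_ : 1 <= _).
    apply: le_trans (_ : c * xM * expR (h * (t0 + M)) <= _).
      apply: ler_pM; rewrite ?expR_ge0 //; first by rewrite mulr_ge0 // ltW.
        by rewrite ler_pM2l.
      by rewrite ler_expR ler_wpM2l // ltW.
    by rewrite -mulrA mulVf // gt_eqF // mulr_gt0 // expR_gt0.
  rewrite ler1n; apply: (@cnt_gt0 _ _ (f u)); first exact: finite_walks.
  by split; [exact: fP|exact: le_trans (t0P u) tt0].
rewrite cnt_walks_rec natrD natr_sum.
apply: le_trans (_ : _ <= \sum_(e : edge G | src e == u)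
  (cnt (walks (dst e) v2 (t - wt e)))%:R) _; last by rewrite lerDr.
rewrite (bigID (fun e => dst e \in C)) /=.
rewrite -[X in X <= _]addr0; apply: lerD; last by apply: sumr_ge0.
rewrite -(xC u uC) mulr_sumr mulr_suml; apply: ler_sum => e /andP[/eqP se dC].
have := IH (t - wt e) _ _ _ dC; rewrite mulrBr expRD => H.
apply: le_trans (H _ _); last 2 first.
- by have := mP e; lra.
- by have := MP e; lra.
by rewrite le_eqVlt; apply/orP; left; apply/eqP; ring.
Qed.

End ExponentialBounds.

(** * Enumerating paths by weight *)

Section Enumeration.
Variables (R : realType) (T : choiceType) (W : T -> R) (X : set T).
Hypothesis X_infinite : infinite_set X.
Hypothesis W_finite : forall t, finite_set (X `&` [set x | W x <= t]).

Lemma next_element (s : seq T) : exists x, [/\ X x, x \notin s &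
  forall y, X y -> y \notin s -> W x <= W y].
Proof.
have [y [Xy ys]] : exists y, X y /\ y \notin s.
  apply/not_existsP => no; apply: X_infinite.
  have Xs : X `<=` [set` s].
    by move=> y Xy; apply/negPn/negP => ys; apply: (no y).
  exact: sub_finite_set Xs (finite_seq s).
pose A := X `&` [set x | W x <= W y].
pose l := [seq x <- fset_set A | x \notin s].
have lP x : (x \in l) = (x \notin s) && `[< A x >].
  by rewrite mem_filter in_fset_set; last exact: W_finite.
have yl : y \in l by rewrite lP ys; apply/asboolP; split => /=.
have [x xl xmin] : exists2 x, x \in l & forall z, z \in l -> W x <= W z.
  move: l yl {lP} => l; elim: l y {Xy ys A} => // a l IH y _.
  have [/hasP[b bl _]|/hasPn nl] := boolP (has xpredT l); last first.
    exists a; first exact: mem_head.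
    by move=> z; rewrite inE => /predU1P[-> //|/nl].
  have [x xl xmin] := IH b bl.
  have [ax|xa] := leP (W a) (W x).
    exists a; first exact: mem_head.
    move=> z; rewrite inE => /predU1P[-> //|/xmin]; exact: le_trans.
  exists x; first by rewrite inE xl orbT.
  by move=> z; rewrite inE => /predU1P[->|/xmin //]; exact: ltW.
move: (xl); rewrite lP => /andP[xs /asboolP[Xx xy]].
exists x; split=> // z Xz zs; have [zy|yz] := leP (W z) (W y).
  by apply: xmin; rewrite lP zs; apply/asboolP; split.
exact: le_trans xy (ltW yz).
Qed.

(** Repeatedly picking a lightest remaining element exhausts [X], because below
    each weight there are only finitely many elements. *)
Lemma sorted_enumeration : exists x : nat -> T,
  [/\ set_bij setT X x & forall q r, (q <= r)%N -> W (x q) <= W (x r)].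
Proof.
have [nxt nxtP] := choice next_element.
pose pre := fix pre n := if n is n'.+1 then rcons (pre n') (nxt (pre n')) else [::].
pose x n := nxt (pre n).
have preS n : pre n.+1 = rcons (pre n) (x n) by [].
have preP y n : reflect (exists2 k, (k < n)%N & y = x k) (y \in pre n).
  elim: n => [|n IH]; first by apply: (iffP idP) => // -[].
  rewrite preS mem_rcons inE; apply: (iffP orP) => [[/eqP ->|/IH[k kn ->]]|[k]].
  - by exists n.
  - by exists k => //; exact: ltnW.
  - rewrite ltnS leq_eqVlt => /predU1P[-> ->|kn yk]; first by left; rewrite eqxx.
    by right; apply/IH; exists k.
have xX n : X (x n) by case: (nxtP (pre n)).
have xnew q r : (q < r)%N -> x q != x r.
  move=> qr; apply/eqP => e; have [_ + _] := nxtP (pre r); move/negP; apply.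
  by apply/preP; exists q.
have xinj : injective x.
  move=> q r e; have [qr|rq|//] := ltngtP q r.
    by move: (xnew _ _ qr); rewrite e eqxx.
  by move: (xnew _ _ rq); rewrite e eqxx.
exists x; split; last first.
  move=> q r qr; have [_ _] := nxtP (pre q); apply; first exact: xX.
  by apply/preP => -[k kq /xinj rk]; rewrite rk in qr; lia.
split=> [n _|q r _ _|y Xy]; [exact: xX|exact: xinj|].
have [[n]|noe] := pselect (exists n, x n = y); first by exists n.
exfalso.
have fA := W_finite (W y).
have := @size_le_cnt _ _
  [seq x i | i <- iota 0 (cnt (X `&` [set z | W z <= W y])).+1] fA.
rewrite size_map size_iota ltnn => contra.
suff : false by []. apply: contra.
  by rewrite map_inj_uniq ?iota_uniq.
move=> z /mapP[i _ ->]; split => //=; have [_ _] := nxtP (pre i); apply => //.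
by apply/preP => -[k _ yk]; apply: noe; exists k.
Qed.

End Enumeration.

Section WeightSequence.
Variables (R : realType) (G : wgraph R) (X : set (seq (edge G))).
Hypothesis X_infinite : infinite_set X.

Local Notation Xle t := (X `&` [set x | path_weight x <= t]).

Lemma finite_sublevel t : finite_set (Xle t).
Proof. by have := @finite_weight_le R G t; apply: sub_finite_set => x []. Qed.

Lemma weight_seqP : enumerates_weights X (weight_seq X).
Proof.
apply: (@getPex _ (enumerates_weights X)).
have [x [[xX xinj xsurj] xmono]] := sorted_enumeration X_infinite finite_sublevel.
exists (fun r => path_weight (x r.-1)); split.
  by move=> q r _ _ qr; apply: xmono; lia.
exists (fun r => x r.-1); split => //; split.
- by move=> r _; exact: xX.
- move=> q r /set_mem[/= q0 _] /set_mem[/= r0 _] /xinj.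
  by rewrite !in_setT => /(_ isT isT); lia.
- move=> y /xsurj[n _ <-]; exists n.+1 => //; split => //.
  apply: card_le_trans (_ : ([set: nat] #<= X)%card); first exact: subset_card_le.
  exact/infiniteP.
Qed.

(** The number of paths of weight at most [t] is a generalized inverse of the
    sequence of weights. *)
Lemma weight_seq_count r : (0 < r)%N -> (r <= cnt (Xle (weight_seq X r)))%N /\
  forall t, t < weight_seq X r -> (cnt (Xle t) < r)%N.
Proof.
have [pmono [x [[xX xinj xsurj] px]]] := weight_seqP.
have D q : (0 < q)%N -> [set q | (0 < q)%N /\ (`I_q #<= X)%card] q.
  move=> q0; split => //.
  apply: card_le_trans (_ : ([set: nat] #<= X)%card); first exact: subset_card_le.
  exact/infiniteP.
move=> r0; split.
  have := @size_le_cnt _ (Xle (weight_seq X r)) [seq x q | q <- iota 1 r]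
    (finite_sublevel _).
  rewrite size_map size_iota; apply.
    rewrite map_inj_in_uniq ?iota_uniq // => q q'.
    rewrite !mem_iota => /andP[q0 _] /andP[q'0 _]; apply: xinj; apply/mem_set; exact: D.
  move=> y /mapP[q]; rewrite mem_iota => /andP[q0 qr] ->.
  split; first exact: (xX q (D _ q0)).
  by rewrite /= -px; [apply: pmono; [exact: D|exact: D|lia]|exact: D].
move=> t tp; apply: (@leq_ltn_trans (size [seq x q | q <- iota 1 r.-1])); last first.
  by rewrite size_map size_iota; lia.
apply: cnt_le_size => y [Xy yt]; have [q Dq xq] := xsurj _ Xy.
have [q0 _] := Dq; apply/mapP; exists q => //; rewrite mem_iota q0 /=.
rewrite add1n prednK // ltnNge; apply/negP => rq.
have := pmono _ _ (D _ r0) Dq rq; rewrite (px q Dq) xq leNgt => /negP; apply.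
exact: le_lt_trans yt tp.
Qed.

End WeightSequence.

(** * Components that are not cycles *)

Lemma near_ln_ge (R : realType) (M : R) :
  \forall r \near \oo, M <= ln (r%:R : R).
Proof.
exists (Num.truncn (expR M)).+1 => // r /= Mr.
rewrite -[M]expRK ler_ln ?posrE ?expR_gt0 ?ltr0n //; last by lia.
apply: ltW; apply: lt_le_trans (truncnS_gt _) _.
by rewrite ler_nat.
Qed.

(** A lower bound for [N] bounds [p] from above and conversely. *)
Lemma exponential_growth_limit (R : realType) (p : nat -> R) (N : R -> nat)
    (h c t0 : R) :
  (forall r, (0 < r)%N ->
     (r <= N (p r))%N /\ forall t, t < p r -> (N t < r)%N) ->
  0 < h -> 0 < c -> (forall t, t0 <= t -> c * expR (h * t) <= (N t)%:R) ->
  (forall eps, 0 < eps ->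
     exists2 K, 0 < K & forall t, (N t)%:R <= K * expR ((h + eps) * t)) ->
  (fun r : nat => p r / ln r%:R) @ \oo --> h^-1.
Proof.
move=> pN h0 c0 lower upper; apply/cvgrPdist_le => eta eta0.
(* [1 / h - 1 / (h + eps)] is then at most [eta / 2]. *)
pose eps := h ^+ 2 * eta / 2.
have eps0 : 0 < eps by rewrite divr_gt0 // mulr_gt0 // exprn_gt0.
have [K K0 KP] := upper eps eps0.
near=> r.
have r0 : (0 < r)%N by near: r; exists 1%N.
have rR : 0 < r%:R :> R by rewrite ltr0n.
have [rN Nr] := pN r r0.
have l1 : 1 <= ln (r%:R : R) by near: r; exact: near_ln_ge.
have lc : `|ln c| <= h * eta * ln r%:R.
  by rewrite -ler_pdivrMl ?mulr_gt0 //; near: r; exact: near_ln_ge.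
have lK : `|ln K| <= h * (eta / 2) * ln r%:R.
  by rewrite -ler_pdivrMl ?mulr_gt0 ?divr_gt0 //; near: r; exact: near_ln_ge.
have lt0 : h * t0 + ln c <= ln r%:R by near: r; exact: near_ln_ge.
set l := ln r%:R in l1 lc lK lt0 *.
have l0 : 0 < l by lra.
have up : h * p r <= l - ln c.
  rewrite leNgt; apply/negP => hp.
  have tp : (l - ln c) / h < p r by rewrite ltr_pdivrMr // mulrC.
  have tt0 : t0 <= (l - ln c) / h by rewrite ler_pdivlMr //; lra.
  have := lower _ tt0; rewrite mulrC [h * _]mulrC divfK ?gt_eqF //.
  rewrite expRD expRN !lnK ?posrE // divfK ?gt_eqF // ler_nat.
  by have := Nr _ tp; rewrite ltnNge => /negP.
have low : l <= ln K + (h + eps) * p r.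
  have : r%:R <= K * expR ((h + eps) * p r).
    by apply: le_trans (KP _); rewrite ler_nat.
  rewrite -[X in _ <= X -> _]lnK ?posrE ?mulr_gt0 ?expR_gt0 //.
  by rewrite lnM ?posrE ?expR_gt0 // expRK /l => H; rewrite -ler_expR lnK.
have Kn := ler_norm (ln K); have cn := ler_norm (- ln c); rewrite normrN in cn.
have u1 : p r / l <= h^-1 + eta.
  rewrite ler_pdivrMr // -(ler_pM2l h0) mulrA mulrDr mulfV ?gt_eqF //.
  by lra.
have u2 : h^-1 - eta <= p r / l.
  have hh0 : 0 < h * (h + eps) by rewrite mulr_gt0 // addr_gt0.
  rewrite ler_pdivlMr // -(ler_pM2l hh0).
  have e1 : h * (h + eps) * ((h^-1 - eta) * l) = (h + eps) * (1 - h * eta) * l.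
    by rewrite mulrBl; field; rewrite gt_eqF.
  rewrite e1.
  have e2 : (h + eps) * (1 - h * eta) <= h - h ^+ 2 * eta / 2.
    have : 0 <= eps * (h * eta) by rewrite mulr_ge0 ?mulr_ge0 // ltW.
    by rewrite /eps; nra.
  apply: le_trans (_ : (h - h ^+ 2 * eta / 2) * l <= _).
    by rewrite ler_pM2r.
  have := ler_wpM2l (ltW h0) low; have := ler_wpM2l (ltW h0) lK.
  by have := ler_wpM2l (ltW h0) Kn; lra.
by rewrite ler_distlC; apply/andP; split; lra.
Unshelve. all: by end_near.
Qed.

Section NonCycle.
Variables (R : realType) (G : wgraph R) (v1 v2 : vertex G).
Local Notation X := (paths v1 v2).
Local Notation U := (Vt X).
Local Notation Xle t := (X `&` [set x | path_weight x <= t]).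
Hypothesis X_neq0 : X !=set0.

Lemma cnt_paths_le t : (cnt (Xle t) <= cnt (walks v1 v2 t))%N.
Proof.
apply: cnt_le; first exact: finite_walks.
by move=> x [+ xt]; rewrite /paths /= path_betweenE => /andP[_ wx].
Qed.

(** A fixed non-empty path from [v1] to [u] is prepended. *)
Lemma cnt_paths_ge u : u \in U -> mutual u u -> exists d, 0 <= d /\
  forall t, (cnt (walks u v2 (t - d)) <= cnt (Xle t))%N.
Proof.
move=> /(VtP _ X_neq0)[[y wy] _] /mutualP[[z]].
rewrite path_betweenE => /andP[z0 wz] _.
exists (path_weight (y ++ z)); split=> [|t]; first exact: path_weight_ge0.
rewrite -(@cnt_image _ _ (cat (y ++ z))); last exact: finite_walks.
  apply: cnt_le; first exact: finite_sublevel.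
  move=> _ [x [wx xt] <-]; split => /=.
    rewrite /paths /= path_betweenE -catA !(walk_trans wy) ?(walk_trans wz) // andbT.
    by case: (y) => //; case: (z) z0.
  by rewrite path_weight_cat; lra.
by move=> x x'; apply: (can_inj (g := drop (size (y ++ z)))) => w; rewrite drop_size_cat.
Qed.

Lemma cycle_path_transfer (D : wgraph R) v :
  is_cycle D -> path_transfer 0 (fun=> 1 : R) (v : vertex D) = 1.
Proof.
move=> [_ /(_ v)[_ out1]]; rewrite path_transferE.
transitivity ((#|[set e : edge D | src e == v]%SET|)%:R : R); last by rewrite out1.
rewrite -sum1_card natr_sum; apply: eq_big => [e|e _]; first by rewrite inE.
by rewrite mul0r oppr0 expR0 mulr1.
Qed.

(** The fixed vector of a component at its own exponent, or the constant vector
    at exponent [0] for a cycle, is contracted at [h + eps]; the factor depends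
    only on [eps] and the least edge weight. *)
Lemma component_supersolution h eps m : 0 < h -> 0 < eps -> 0 < m ->
  (forall e : edge G, m <= wt e) ->
  (forall C, C \in sccs_on U -> ~ is_cycle (induced C) ->
     h^-1 <= s_value (induced C)) ->
  forall S : {set vertex G}, exists x : vertex G -> R, (forall v, 0 < x v) /\
     forall u, u \in U -> scc_of u = S ->
       \sum_(e : edge G | (src e == u) && (dst e \in S))
          expR (- ((h + eps) * wt e)) * x (dst e) <= expR (- (eps * m)) * x u.
Proof.
move=> hpos eps0 m0 mP hS S; have h0 := ltW hpos.
have [SU|nSU] := boolP (S \in sccs_on U); last first.
  exists (fun=> 1); split=> // u uU uS; rewrite big_pred0 ?mulr1 ?expR_ge0 // => e.
  case: eqP => //= se; apply/negP => eS; move/negP: nSU; apply.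
  apply/sccs_onP; first exact: convex_Vt.
  exists u; split => //; rewrite -scc_of_neq0 uS.
  by apply/set0Pn; exists (dst e).
have /sccs_onP-/(_ (convex_Vt X_neq0))[u0 [u0U u0u0 SE]] := SU.
have sS : strongly_connected (induced S).
  by rewrite SE; exact: induced_scc_strongly_connected.
have v0 : exists v : vertex (induced S), True.
  by have u0S : u0 \in S; [rewrite SE mem_scc | exists (exist _ u0 u0S)].
have [hC [x [hC0 hCh x0 xE]]] : exists hC, exists x : vertex (induced S) -> R,
    [/\ 0 <= hC, hC <= h, (forall v, 0 < x v) & forall v, path_transfer hC x v = x v].
  have [cyc|ncyc] := pselect (is_cycle (induced S)).
    by exists 0, (fun=> 1); split=> // v; exact: cycle_path_transfer.
  have [hC hC0 [x x0 xE]] := not_cycle_fixpoint sS v0 ncyc.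
  exists hC, x; split=> //; first exact: ltW.
  have := hS S SU ncyc.
  rewrite (s_value_unique (strongly_connected_irreducible sS) v0 hC0 x0 xE).
  by rewrite lef_pV2.
exists (extend x); split=> [v|u uU uS]; first exact: extend_gt0.
have [uu|nuu] := boolP (mutual u u); last first.
  rewrite big_pred0 ?mulr_ge0 ?expR_ge0 ?ltW ?extend_gt0 // => e.
  case: eqP => //= se; apply/negP; rewrite -uS mem_scc => /mutual_refl.
  exact/negP.
have uSin : u \in S by rewrite -uS mem_scc.
pose a : vertex (induced S) := exist _ u uSin.
have := extend_transfer x (h + eps) a => /= ->.
have hh : hC <= h + eps by lra.
have mP' (e : edge (induced S)) : m <= wt e by exact: mP.
apply: le_trans (path_transfer_contract a hh mP' (fun v => ltW (x0 v))) _.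
rewrite xE /extend insubT; apply: ler_pM; rewrite ?expR_ge0 ?ler_expR //.
- exact: ltW.
- by rewrite lerN2 ler_pM2r //; lra.
Qed.

Lemma growth_noncycle (s : R) :
  let S := [set s_value (induced C) | C in
              [set C | C \in sccs_on U /\ ~ is_cycle (induced C)]] in
  S s -> lbound S s ->
  (fun r : nat => weight_seq X r / ln r%:R) @ \oo --> s.
Proof.
move=> S [C /= [CU ncyc] Cs] sS.
have /sccs_onP-/(_ (convex_Vt X_neq0))[u [uU uu CE]] := CU.
have sC : strongly_connected (induced C).
  by rewrite CE; exact: induced_scc_strongly_connected.
have uC : u \in C by rewrite CE mem_scc.
have v0 : exists v : vertex (induced C), True by exists (exist _ u uC).
have [h h0 [x x0 xE]] := not_cycle_fixpoint sC v0 ncyc.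
have sE : s = h^-1.
  by rewrite -Cs (s_value_unique (strongly_connected_irreducible sC) v0 h0 x0 xE).
rewrite sE in Cs sS *.
have [d [d0 dP]] := cnt_paths_ge uU uu.
have [c c0 [t0 low]] : exists2 c, 0 < c &
    exists t0, forall u t, u \in C -> t0 <= t -> c * expR (h * t) <= (cnt (walks u v2 t))%:R.
  apply: (walk_count_lower (ltW h0) (fun v => extend_gt0 v x0)) => v vC.
    have := extend_transfer x h (exist _ v vC) => /= ->; rewrite xE.
    by rewrite /extend insubT; congr x; apply: val_inj.
  rewrite CE mem_scc mutual_sym in vC.
  apply: access_trans (mutual_access vC) _.
  by have /(VtP _ X_neq0)[] := uU.
have lower t : t0 + d <= t ->
    c * expR (- (h * d)) * expR (h * t) <= (cnt (Xle t))%:R.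
  move=> t0t; apply: le_trans (_ : (cnt (walks u v2 (t - d)))%:R <= _); last first.
    by rewrite ler_nat.
  apply: le_trans (low _ (t - d) uC _); last by lra.
  by rewrite mulrBr [h * t - _]addrC expRD mulrA.
have cc0 : 0 < c * expR (- (h * d)) by rewrite mulr_gt0 // expR_gt0.
have Xinf : infinite_set X.
  move=> Xfin; pose cc := c * expR (- (h * d)).
  pose t := Num.max (t0 + d) ((cnt X)%:R / (cc * h)).
  have t1 : t0 + d <= t by rewrite le_max lexx.
  have t2 : (cnt X)%:R / (cc * h) <= t by rewrite le_max lexx orbT.
  have := lower t t1; rewrite leNgt => /negP; apply.
  apply: le_lt_trans (_ : _ <= (cnt X)%:R) _.
    by rewrite ler_nat; apply: cnt_le => // y [].
  apply: le_lt_trans (_ : _ <= cc * (h * t)) _.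
    by rewrite mulrA mulrC -ler_pdivrMr //; exact: mulr_gt0 cc0 h0.
  by rewrite ltr_pM2l //; have := expR_ge1Dx (h * t); lra.
apply: (exponential_growth_limit (weight_seq_count Xinf) h0 cc0 lower) => eps eps0.
have [m m0 mP] := wt_lower_bound G.
have [||y y0 [th' th1 yP]] := @supersolution R G U (h + eps) (expR (- (eps * m))).
- by rewrite expR_ge0 -expR0 ltr_expR oppr_lt0 mulr_gt0.
- by apply: component_supersolution => // C' C'U nC'; apply: sS; exists C'.
have hh0 : 0 <= h + eps by lra.
have [|K K0 KP] := walk_count_upper (v2 := v2) hh0 th1 y0 yP.
  move=> e /(VtP _ X_neq0)[v1e _] ev2; apply/(VtP _ X_neq0); split => //.
  exact: access_trans v1e (access_edge e).
exists K => // t; apply: le_trans (KP v1 t _).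
  by rewrite ler_nat cnt_paths_le.
apply/(VtP _ X_neq0); split; first exact: access_refl.
have [z] := X_neq0; rewrite /paths /= path_betweenE => /andP[_ wz].
by exists z.
Qed.

End NonCycle.

(** * Computing itineraries *)

Section Itineraries.
Variables (R : realType) (G : wgraph R).
Implicit Types (a b c d u v : vertex G) (s t : seq (vertex G)).
Implicit Types (x y : seq (edge G)).

Definition shorten_cons a s : seq (vertex G) :=
  if s is b :: c :: r then
    if mutual a b && mutual b c then a :: c :: r else a :: s
  else a :: s.

(** The itinerary of a path with list of vertices [s], computed from the end. *)
Fixpoint shorten s : seq (vertex G) :=
  if s is a :: s' then shorten_cons a (shorten s') else [::].

Fixpoint reduced s : bool :=
  if s is a :: s' then
    (if s' is b :: c :: _ then ~~ (mutual a b && mutual b c) else true)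
    && reduced s'
  else true.

Lemma shorten_head a s : exists r, shorten (a :: s) = a :: r.
Proof.
rewrite /= /shorten_cons; case: (shorten s) => [|b [|c r]]; try by eexists.
by case: ifP; eexists.
Qed.

(** Overlapping steps have the same outcome because mutual accessibility is
    transitive; hence a list has only one normal form. *)
Lemma shorten_invariant s t : itinerary_step s t -> shorten s = shorten t.
Proof.
move=> [l [a [b [c [r [-> -> ab bc]]]]]].
elim: l => [|h l IH] /=; last by rewrite IH.
have ac := mutual_trans ab bc.
have [r' ->] : exists r', shorten_cons c (shorten r) = c :: r'.
  exact: (shorten_head c r).
case: r' => [|d r'] /=; first by rewrite ab bc.
have [cd|ncd] := boolP (mutual c d).
  by rewrite bc /= ab ac (mutual_trans bc cd).
by rewrite andbF /= ab bc andbF.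
Qed.

Lemma shorten_reduced s : reduced (shorten s).
Proof.
elim: s => //= a s; case: (shorten s) => [|b [|c r]] //= /andP[H1 H2].
case: ifP => [/andP[ab bc]|nabc] /=; last by rewrite nabc H1 H2.
rewrite H2 andbT; case: r H1 {H2} => // d r; rewrite bc /=.
by move=> ncd; rewrite (negPf ncd) andbF.
Qed.

Lemma shorten_id s : reduced s -> shorten s = s.
Proof.
elim: s => //= a s IH /andP[H /IH ->].
by case: s {IH} H => [|b [|c r]] //= /negPf ->.
Qed.

Lemma reducedP s : reduced s <-> forall t, ~ itinerary_step s t.
Proof.
split=> [rs t [l [a [b [c [r [sE _ ab bc]]]]]]|].
  move: rs; rewrite sE {sE}.
  elim: l => [|h l IH] /= => [/andP[]|/andP[_ /IH //]].
  by rewrite ab bc.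
elim: s => //= a s IH H; apply/andP; split.
  case: s IH H => [|b [|c r]] // _ H; apply/negP => /andP[ab bc].
  by apply: (H (a :: c :: r)); exists [::], a, b, c, r.
apply: IH => t [l [a' [b [c [r [sE tE ab bc]]]]]].
by apply: (H (a :: t)); exists (a :: l), a', b, c, r; rewrite sE tE.
Qed.

Lemma shorten_steps s :
  clos_refl_trans _ (@itinerary_step R G) s (shorten s).
Proof.
elim: s => [|a s IH] /=; first exact: rt_refl.
have lift t t' : clos_refl_trans _ (@itinerary_step R G) t t' ->
    clos_refl_trans _ (@itinerary_step R G) (a :: t) (a :: t').
  elim=> [{}t {}t' [l [a' [b [c [r [-> -> ab bc]]]]]]|{}t|{}t t1 t2 _ H1 _ H2].
  - by apply: rt_step; exists (a :: l), a', b, c, r.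
  - exact: rt_refl.
  - exact: rt_trans H1 H2.
apply: rt_trans (lift _ _ IH) _.
case: (shorten s) => [|b [|c r]] /=; try exact: rt_refl.
case: ifP => [/andP[ab bc]|_]; last exact: rt_refl.
by apply: rt_step; exists [::], a, b, c, r.
Qed.

Lemma is_itineraryE x s : is_itinerary x s <-> s = shorten (vertex_list x).
Proof.
split=> [[st /reducedP rs]|->]; last first.
  by split; [exact: shorten_steps|apply/reducedP/shorten_reduced].
rewrite -[LHS](shorten_id rs); apply/esym.
elim: st {rs} => [t t' /shorten_invariant|//|t t1 t2 _ -> _ ->] //.
Qed.

Definition linked a b := mutual a b || (edges_between a b != finset.set0).

Lemma shorten_path a s : path linked a s ->
  exists r, [/\ shorten (a :: s) = a :: r, path linked a r,
                last a r = last a s & {subset r <= a :: s}].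
Proof.
elim: s a => [|b s IH] a; first by exists [::].
rewrite [path _ _ _]/= => /andP[ab /IH[r [E pr lr sr]]].
have -> : shorten (a :: b :: s) = shorten_cons a (b :: r) by rewrite -E.
have sbr : {subset b :: r <= a :: b :: s}.
  move=> z; rewrite inE => /predU1P[->|/sr]; first by rewrite !inE eqxx orbT.
  by rewrite [z \in a :: _]inE => ->; rewrite orbT.
case: r E pr lr sr sbr => [|c r] E pr lr sr sbr.
  by exists [:: b]; split=> //=; rewrite ab.
rewrite [shorten_cons _ _]/=; case: ifP => [/andP[mab mbc]|_].
  exists (c :: r); split=> //.
  - move: pr => /= /andP[_ ->]; rewrite andbT /linked.
    by rewrite (mutual_trans mab mbc).
  - by move=> z zr; apply: sbr; rewrite inE zr orbT.
by exists (b :: c :: r); split=> //=; rewrite ab; exact: pr.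
Qed.

Definition pairs s : seq (vertex G * vertex G) := zip s (behead s).

Definition njump s : nat := \sum_(p <- pairs s) mutual p.1 p.2.

Lemma njump_cons a b s : njump (a :: b :: s) = (mutual a b + njump (b :: s))%N.
Proof. by rewrite /njump /pairs /= big_cons. Qed.

Lemma njump1 a : njump [:: a] = 0%N.
Proof. by rewrite /njump big_nil. Qed.

Definition traversed x : {set {set vertex G}} :=
  [set C | has (fun e => mutual (src e) (dst e) && (scc_of (src e) == C)) x]%SET.

Lemma traversedP x C : reflect
  (exists e, [/\ e \in x, mutual (src e) (dst e) & C = scc_of (src e)])
  (C \in traversed x).
Proof.
rewrite inE; apply: (iffP hasP) => [[e ex /andP[m /eqP <-]]|[e [ex m ->]]].
  by exists e.
by exists e => //; rewrite m eqxx.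
Qed.

Lemma traversed_cat x y : traversed (x ++ y) = (traversed x :|: traversed y)%SET.
Proof. by apply/setP => C; rewrite !inE has_cat. Qed.

Lemma walk_access_edge u v x e : walk u v x -> e \in x -> access u (src e).
Proof.
elim: x u => //= d x IH u /andP[/eqP <- wx]; rewrite inE => /predU1P[->|ex].
  exact: access_refl.
exact: access_trans (access_edge d) (IH _ wx ex).
Qed.

(** A jump of the itinerary stands for a maximal run of edges of the path inside
    a component, and a path never comes back to a component it has left. *)
Lemma njump_shorten u v x : walk u v x ->
  njump (shorten (u :: map dst x)) = #|traversed x|.
Proof.
elim: x u => [|e x IH] u wx.
  rewrite /= njump1; apply/esym/eqP; rewrite cards_eq0; apply/eqP/setP => C.
  by rewrite !inE.
move: wx => /= /andP[/eqP su wx]; have := IH _ wx; rewrite -{}su {u IH}.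
have -> : traversed (e :: x) = (traversed [:: e] :|: traversed x)%SET.
  by rewrite -traversed_cat.
have [m|nm] := boolP (mutual (src e) (dst e)); last first.
  have -> : traversed [:: e] = finset.set0.
    by apply/setP => C; rewrite !inE /= (negPf nm).
  rewrite finset.set0U => <-; have [r /= ->] := shorten_head (dst e) (map dst x).
  case: r => [|c r]; rewrite /= ?(negPf nm) /=.
    by rewrite njump_cons (negPf nm).
  by rewrite njump_cons (negPf nm).
have tE : traversed [:: e] = [set scc_of (src e)]%SET.
  by apply/setP => C; rewrite !inE /= m orbF eq_sym.
rewrite tE; case: x wx => [|d x] wx.
  have -> : traversed [::] = finset.set0 by apply/setP => C; rewrite !inE.
  by rewrite finset.setU0 cards1 /= njump_cons m njump1.
move: wx => /= /andP[/eqP sd wx].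
have [r E] := shorten_head (dst d) (map dst x).
have [c [r' [E' mE]]] : exists c r',
    shorten (dst e :: dst d :: map dst x) = dst e :: c :: r' /\
    mutual (dst e) c = mutual (dst e) (dst d).
  rewrite [shorten _]/= -/(shorten (dst d :: map dst x)) E.
  case: r {E} => [|c r] /=; first by exists (dst d), [::].
  case: ifP => [/andP[m1 m2]|_]; last by exists (dst d), (c :: r).
  by exists c, r; rewrite (mutual_trans m1 m2) m1.
have -> : shorten_cons (dst e) (shorten_cons (dst d) (shorten (map dst x))) =
    dst e :: c :: r' by rewrite -E'.
have -> : #|([set scc_of (src e)] :|: traversed (d :: x))%SET| =
    (~~ mutual (dst e) (dst d) + #|traversed (d :: x)|)%N.
  rewrite cardsU1; congr (~~ _ + _)%N.
  apply/traversedP/idP => [[f [+ mf Ef]]|md]; last first.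
    exists d; rewrite mem_head sd; split=> //.
    by rewrite (scc_of_eq m).
  have sef : mutual (src e) (src f) by rewrite -mem_scc Ef mem_scc; exact: mutual_refl mf.
  have def : mutual (src f) (dst e).
    by rewrite mutual_sym in sef; exact: mutual_trans sef m.
  rewrite inE => /predU1P[fd|fx]; first by rewrite -sd -fd.
  apply: access_mutual; first by rewrite -sd; exact: reaches_edge.
  exact: access_trans (walk_access_edge wx fx) (mutual_access def).
move=> <-; rewrite /= m /= mE; case: ifP => md.
  by rewrite !njump_cons mE md (mutual_trans m (etrans mE md)).
by rewrite !njump_cons mE md m.
Qed.

(** A loop is inserted at each vertex that lies on one. *)
Lemma exists_traversing u v x : walk u v x -> exists y,
  [/\ walk u v y, (x != [::] -> y != [::]) &
    forall w, w \in u :: map dst x -> mutual w w -> scc_of w \in traversed y].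
Proof.
have loop w : exists l, walk w w l /\
    (mutual w w -> scc_of w \in traversed l).
  have [mw|nmw] := boolP (mutual w w); last first.
    by exists [::]; rewrite /= eqxx.
  have /mutualP[[l]] := mw; rewrite path_betweenE; case: l => //= e l /andP[/eqP se wl] _.
  exists (e :: l); rewrite /= se eqxx; split=> // _.
  apply/traversedP; exists e; rewrite mem_head se; split=> //.
  apply: access_mutual; last by exists l.
  by rewrite -se; exact: reaches_edge.
elim: x u => [|e x IH] u wx.
  have [l [wl lt]] := loop u; exists l; split=> //; first by move/eqP: wx => <-.
  by move=> w; rewrite inE => /eqP ->.
move: wx => /= /andP[/eqP su /IH[y [wy _ yP]]].
have [l [wl lt]] := loop u; exists (l ++ e :: y); split=> //.
- by apply: walk_trans wl _; rewrite /= su eqxx.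
- by move=> _; case: (l).
- move=> w; rewrite inE traversed_cat => /predU1P[->|wx] mw; apply/setUP.
    by left; exact: lt.
  by right; rewrite -cat1s traversed_cat; apply/setUP; right; exact: yP.
Qed.

End Itineraries.

(** * Recursions for the walks with a given itinerary *)

Section ItineraryCounts.
Variables (R : realType) (G : wgraph R) (z : vertex G).
Implicit Types (a b c : vertex G) (s r : seq (vertex G)).
Implicit Types (x y : seq (edge G)).

Definition iwalks a s (t : R) : set (seq (edge G)) :=
  [set x | [/\ walk a z x, shorten (a :: map dst x) = s & path_weight x <= t]].

Lemma finite_iwalks a s t : finite_set (iwalks a s t).
Proof.
by have := @finite_weight_le R G t; apply: sub_finite_set => x [].
Qed.

Lemma cnt_iwalks_le a s t t' : t <= t' ->
  (cnt (iwalks a s t) <= cnt (iwalks a s t'))%N.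
Proof.
move=> tt'; apply: cnt_le; first exact: finite_iwalks.
by move=> x [? ? xt]; split => //; exact: le_trans xt tt'.
Qed.

Lemma shorten_head2 a b s : exists c r, shorten (a :: b :: s) = a :: c :: r.
Proof.
rewrite [shorten _]/= -/(shorten (b :: s)).
have [r ->] := shorten_head b s; case: r => [|c r] /=; first by exists b, [::].
by case: ifP => _; [exists c, r|exists b, (c :: r)].
Qed.

Local Arguments shorten : simpl never.

Lemma shorten_consE a b c r s : reduced (a :: b :: s) ->
  (shorten_cons a (c :: r) == a :: b :: s) =
  (c :: r == b :: s) || [&& c :: r == c :: b :: s, mutual a c & mutual c b].
Proof.
move=> red; case: r => [|d r] /=.
  by rewrite !eqseq_cons eqxx /= andbF /= orbF.
case: ifP => [/andP[ac cd]|nacd]; rewrite !eqseq_cons !eqxx /=.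
  rewrite ac /=; case: (d =P b) => [db|_] /=.
    rewrite -db cd andbT; case: (r =P s) => [|_]; first by rewrite orbT.
    rewrite orbF; apply/esym/negP => /andP[/eqP cb /eqP rs].
    by rewrite -cb in cd; move: red; rewrite -rs -db -cb /= ac cd.
  by rewrite orbF; apply/esym/negP => /andP[/eqP cb /eqP rs];
     move: red; rewrite -rs -cb /= ac cd.
case: (d =P b) => [db|_] /=; last by rewrite orbF.
by rewrite -db nacd andbF orbF.
Qed.

Lemma cnt_iwalks1 a t : cnt (iwalks a [:: a] t) = (a == z) && (0 <= t) :> nat.
Proof.
rewrite cnt_cons; last exact: finite_iwalks.
rewrite big1 ?addn0 => [|e _].
  congr nat_of_bool; apply/asboolP/andP; rewrite /iwalks /= path_weight_nil.
    by case.
  by case.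
apply: cnt0; apply/seteqP; split=> // x [_ + _].
by have [c [r ->]] := shorten_head2 a (dst e) (map dst x).
Qed.

Lemma cnt_iwalks_cons a b s t : cnt (iwalks a (a :: b :: s) t) =
  (\sum_(e : edge G | src e == a) cnt [set x | [/\ walk (dst e) z x,
     shorten_cons a (shorten (dst e :: map dst x)) == a :: b :: s &
     (path_weight x <= t - wt e)%R]])%N.
Proof.
rewrite cnt_cons; last exact: finite_iwalks.
have -> : `[< iwalks a (a :: b :: s) t [::] >] = false.
  by apply/asboolP => -[].
rewrite [RHS]big_mkcond /= add0n; apply: eq_bigr => e _.
case: eqP => [se|nse]; last first.
  by apply: cnt0; apply/seteqP; split=> // x [/andP[/eqP]].
congr cnt; apply/seteqP; split => x; rewrite /iwalks /= path_weight_cons.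
  case=> /andP[_ ->] E ?; split=> //; last by lra.
  exact/eqP.
case=> -> /eqP E ?; rewrite se eqxx; split=> //; by lra.
Qed.

(** The first step goes along an edge from [a] to [b], and the rest of the walk
    has the rest of the itinerary. *)
Lemma cnt_iwalks_edge a b s t : reduced (a :: b :: s) -> ~~ mutual a b ->
  cnt (iwalks a (a :: b :: s) t) =
  (\sum_(e in edges_between a b) cnt (iwalks b (b :: s) (t - wt e)%R))%N.
Proof.
move=> red nab; rewrite cnt_iwalks_cons.
rewrite (bigID (fun e => dst e == b)) /= [X in (_ + X)%N]big1 ?addn0.
  apply: eq_big => [e|e /andP[_ /eqP de]]; first by rewrite inE.
  subst b; congr cnt; apply/seteqP; split => x.
    move=> [wx + xt]; have [r E] := shorten_head (dst e) (map dst x).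
    rewrite E shorten_consE // => /orP[/eqP er|/and3P[_ m1 m2]].
      by split=> //; rewrite E.
    by move: nab; rewrite (mutual_trans m1 m2).
  by move=> [wx E xt]; split=> //; rewrite E shorten_consE // eqxx.
move=> e /andP[_ nde]; apply: cnt0; apply/seteqP; split=> // x [_ + _].
have [r ->] := shorten_head (dst e) (map dst x); rewrite shorten_consE //.
case/orP => [/eqP[de _]|/and3P[_ m1 m2]]; first by rewrite de eqxx in nde.
by move: nab; rewrite (mutual_trans m1 m2).
Qed.

(** The first step stays in the component; the walk either enters [b] for the
    last time before leaving, or [b] is still to come and the itinerary of the
    rest begins with the new vertex in place of [a]. *)
Lemma cnt_iwalks_mutual a b s t : reduced (a :: b :: s) -> mutual a b ->
  cnt (iwalks a (a :: b :: s) t) =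
  (\sum_(e : edge G | (src e == a) && mutual a (dst e))
     (((dst e == b) * cnt (iwalks b (b :: s) (t - wt e)%R))
      + cnt (iwalks (dst e) (dst e :: b :: s) (t - wt e)%R)))%N.
Proof.
move=> red mab; rewrite cnt_iwalks_cons.
rewrite (bigID (fun e => mutual a (dst e))) /= [X in (_ + X)%N]big1 ?addn0.
  apply: eq_bigr => e /andP[_ mae].
  have meb : mutual (dst e) b.
    by rewrite mutual_sym in mae; exact: mutual_trans mae mab.
  rewrite -[X in (X + _)%N](_ : cnt [set x | dst e = b /\
    iwalks b (b :: s) (t - wt e) x] = _); last first.
    case: eqP => [de|nde]; last first.
      by rewrite mul0n; apply: cnt0; apply/seteqP; split=> // x [].
    by rewrite mul1n; congr cnt; apply/seteqP; split => x // -[].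
  rewrite -cnt_setU; first last.
  - move=> x [de [_ + _]] [_ + _]; rewrite de => -> /(congr1 size) /= /eqP.
    by rewrite -[X in X == _]addn0 -[in X in _ == X]addn1 eqn_add2l.
  - exact: finite_iwalks.
  - by have := @finite_weight_le R G (t - wt e); apply: sub_finite_set => x [_ []].
  congr cnt; apply/seteqP; split => x.
    move=> [wx + xt]; have [r E] := shorten_head (dst e) (map dst x).
    rewrite E shorten_consE // => /orP[/eqP er|/and3P[/eqP er _ _]].
      have de : dst e = b by case: er.
      by left; split => //; split=> //; rewrite -de ?E // er de.
    by right; split=> //; rewrite E.
  case=> [[de [wx Es xt]]|[wx Es xt]]; split=> //; rewrite ?de //.
    by rewrite Es shorten_consE // eqxx.
  by rewrite Es shorten_consE // mae meb !eqxx orbT.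
move=> e /andP[_ nae]; apply: cnt0; apply/seteqP; split=> // x [_ + _].
have [r ->] := shorten_head (dst e) (map dst x); rewrite shorten_consE //.
case/orP => [/eqP[de _]|/and3P[_ m1 m2]]; last by rewrite m1 in nae.
by rewrite de mab in nae.
Qed.

End ItineraryCounts.

(** A recursion along a cyclic permutation, unrolled once around. *)
Section Unroll.
Variables (R : realType) (T : finType) (f : T -> T) (w : T -> R).
Variables (g : T -> R -> R) (k : R -> R) (b : T).
Hypothesis f_inj : injective f.
Hypothesis f_conn : forall u v, fconnect f u v.
Hypothesis w_ge0 : forall u, 0 <= w u.
Hypothesis g_rec : forall u t,
  g u t = (f u == b)%:R * k (t - w u) + g (f u) (t - w u).

Lemma unroll_cycle a : exists2 d, 0 <= d &
  forall t, g a t = k (t - d) + g a (t - \sum_u w u).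
Proof.
pose S n := \sum_(i < n) w (iter i f a).
have unroll n t : g a t =
    (\sum_(i < n) (iter i.+1 f a == b)%:R * k (t - S i.+1)) + g (iter n f a) (t - S n).
  elim: n => [|n IH]; first by rewrite /S !big_ord0 add0r subr0.
  rewrite big_ord_recr /= -addrA IH g_rec; congr (_ + _).
  by rewrite /S big_ord_recr /= opprD addrA.
have ordT u : order f u = #|T| by apply: eq_card => v; rewrite inE; exact: f_conn.
have sumw : S (order f a) = \sum_u w u.
  have -> : S (order f a) = \sum_(u <- orbit f a) w u.
    rewrite /orbit (big_nth a) size_traject big_mkord.
    by apply: eq_bigr => i _; rewrite nth_traject.
  rewrite -big_enum; apply: perm_big; apply: uniq_perm.
  - exact: orbit_uniq.
  - exact: enum_uniq.
  - by move=> u; rewrite -fconnect_orbit f_conn mem_enum.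
pose i0 := findex f (f a) b.
have i0lt : (i0 < order f a)%N by rewrite ordT -(ordT (f a)) findex_max.
have fi0 : iter i0 f (f a) = b by rewrite iter_findex.
exists (S i0.+1) => [|t]; first exact: sumr_ge0.
rewrite (unroll (order f a) t) iter_order // sumw; congr (_ + _).
rewrite (bigD1 (Ordinal i0lt)) //= big1 => [|i ine]; last first.
  suff /negPf -> : iter i.+1 f a != b by rewrite mul0r.
  apply: contra ine; rewrite iterSr -fi0 => /eqP ii0.
  apply/eqP/val_inj => /=; rewrite -[LHS](@findex_iter _ f (f a)).
    by rewrite ii0 findex_iter // (ordT (f a)) -(ordT a).
  by rewrite (ordT (f a)) -(ordT a).
by rewrite -iterS iterSr fi0 eqxx mul1r addr0.
Qed.

End Unroll.

(** * Polynomial growth *)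

Section PolynomialGrowth.
Variable R : realType.
Implicit Types (f g : R -> R) (L : R) (m : nat).

(** Asymptotics [L t^m] with an error that amounts to a bounded shift of [t];
    unlike an asymptotic equivalence, this is stable under recursion without
    any loss. *)
Definition poly_growth f L m : Prop := exists2 K : R, 0 <= K &
  forall t, K <= t -> L * (t - K) ^+ m <= f t <= L * (t + K) ^+ m.

Lemma poly_growth_shift f L m d : 0 <= L -> 0 <= d ->
  poly_growth f L m -> poly_growth (fun t => f (t - d)) L m.
Proof.
move=> L0 d0 [K K0 KP]; exists (K + d) => [|t tK]; first lra.
have /KP/andP[lo up] : K <= t - d by lra.
apply/andP; split.
  by rewrite opprD addrA addrAC.
apply: le_trans up _; rewrite ler_wpM2l // lerXn2r ?nnegrE //; lra.
Qed.

Lemma pow_diff_ge (x y : R) m : 0 <= y -> y <= x ->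
  m.+1%:R * (x - y) * y ^+ m <= x ^+ m.+1 - y ^+ m.+1.
Proof.
move=> y0 yx; elim: m => [|m IH]; first by rewrite !expr1 expr0 mulr1 mul1r.
rewrite [x ^+ _]exprS [y ^+ m.+2]exprS [y ^+ m.+1]exprS.
have e1 : x * x ^+ m.+1 - y * (y * y ^+ m) =
    x * (x ^+ m.+1 - y ^+ m.+1) + (x - y) * y ^+ m.+1.
  by rewrite [y ^+ m.+1]exprS; ring.
have y1 : 0 <= y ^+ m by rewrite exprn_ge0.
have h1 : y * (m.+1%:R * (x - y) * y ^+ m) <= x * (x ^+ m.+1 - y ^+ m.+1).
  apply: ler_pM => //; rewrite !mulr_ge0 ?ler0n // subr_ge0 //.
rewrite e1 -natr1; rewrite [y ^+ m.+1]exprS in h1 *; lra.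
Qed.

Lemma pow_diff_le (x y : R) m : 0 <= y -> y <= x ->
  x ^+ m.+1 - y ^+ m.+1 <= m.+1%:R * (x - y) * x ^+ m.
Proof.
move=> y0 yx; elim: m => [|m IH]; first by rewrite !expr1 expr0 mulr1 mul1r.
have x0 : 0 <= x by lra.
have e1 : x ^+ m.+2 - y ^+ m.+2 =
    x * (x ^+ m.+1 - y ^+ m.+1) + (x - y) * y ^+ m.+1.
  by rewrite !exprS; ring.
have h1 : x * (x ^+ m.+1 - y ^+ m.+1) <= x * (m.+1%:R * (x - y) * x ^+ m).
  by rewrite ler_wpM2l.
have h2 : (x - y) * y ^+ m.+1 <= (x - y) * x ^+ m.+1.
  by rewrite ler_wpM2l ?subr_ge0 // lerXn2r ?nnegrE.
rewrite e1 -natr1; rewrite [x ^+ m.+1]exprS in h1 h2 *; lra.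
Qed.

(** The equation says that [f] is a discrete integral of [g] with step [omega].
    With [L'] the new constant, [L' * (u ^+ m.+1 - (u - omega) ^+ m.+1)] lies
    between [L * (u - omega) ^+ m] and [L * u ^+ m], so that shifted powers are
    super- and subsolutions. *)
Lemma poly_growth_cycle f g L m (d omega : R) : 0 < L -> 0 <= d -> 0 < omega ->
  (forall t, 0 <= f t) -> {homo f : t t' / t <= t'} ->
  (forall t, f t = g (t - d) + f (t - omega)) ->
  poly_growth g L m -> poly_growth f (L / (m.+1%:R * omega)) m.+1.
Proof.
move=> L0 d0 w0 f0 fmono frec [K K0 KP].
have mw0 : 0 < m.+1%:R * omega by rewrite mulr_gt0 // ltr0n.
set L' := L / _.
have L'0 : 0 < L' by rewrite divr_gt0.
have LE : L = L' * (m.+1%:R * omega) by rewrite /L' divfK // gt_eqF.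
pose F := f (K + d + omega).
(* The last summand makes the bound hold on the initial interval. *)
pose K1 := K + d + omega + 1 + F / L'.
have F0 : 0 <= F / L' by apply: divr_ge0; [exact: f0|exact: ltW].
have up t : 0 <= t -> f t <= L' * (t + K1) ^+ m.+1.
  move: t; apply: (real_step_ind w0 (t0 := K + d + omega)) => [t tT t0|t tT IH t0].
    apply: le_trans (_ : F <= _); first by apply: fmono; exact: ltW.
    rewrite -ler_pdivrMl // mulrC; apply: le_trans (_ : t + K1 <= _).
      by rewrite /K1; lra.
    by apply: ler_eXnr => //; rewrite /K1; lra.
  rewrite frec; have /KP/andP[_ gup] : K <= t - d by lra.
  have fup := IH (t - omega) (lexx _) ltac:(lra).
  have y0 : 0 <= t - omega + K1 by rewrite /K1; lra.
  have := @pow_diff_ge (t + K1) (t - omega + K1) m y0 ltac:(lra).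
  rewrite (_ : t + K1 - (t - omega + K1) = omega); last by ring.
  move=> /(ler_wpM2l (ltW L'0)); rewrite mulrA -LE => hd.
  have h2 : L * (t - d + K) ^+ m <= L * (t - omega + K1) ^+ m.
    by rewrite ler_wpM2l ?(ltW L0) // lerXn2r ?nnegrE // /K1; lra.
  lra.
pose K2 := K + d.
have low t : K2 <= t -> L' * (t - K2) ^+ m.+1 <= f t.
  move: t; apply: (real_step_ind w0 (t0 := K2 + omega)) => [t tT t0|t tT IH t0].
    have /KP/andP[glo _] : K <= t - d by rewrite /K2 in t0 *; lra.
    rewrite frec; apply: le_trans (_ : g (t - d) <= _); last by rewrite lerDl.
    apply: le_trans glo; rewrite (_ : t - d - K = t - K2); last by rewrite /K2; ring.
    set u := t - K2; have u0 : 0 <= u by rewrite subr_ge0.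
    rewrite exprS mulrA ler_wpM2r ?exprn_ge0 // LE ler_pM2l //.
    apply: le_trans (_ : omega <= _); first by rewrite /u; lra.
    by rewrite ler_peMl ?(ltW w0) // ler1n.
  rewrite frec; have /KP/andP[glo _] : K <= t - d by rewrite /K2 in t0 *; lra.
  have flo := IH (t - omega) (lexx _) ltac:(lra).
  have y0 : 0 <= t - omega - K2 by lra.
  have := @pow_diff_le (t - K2) (t - omega - K2) m y0 ltac:(lra).
  rewrite (_ : t - K2 - (t - omega - K2) = omega); last by ring.
  move=> /(ler_wpM2l (ltW L'0)); rewrite mulrA -LE => hd.
  rewrite (_ : t - d - K = t - K2) in glo; last by rewrite /K2; ring.
  lra.
exists (K1 + K2) => [|t tK]; first by rewrite /K1 /K2; lra.
have K10 : 0 <= K1 by rewrite /K1; lra.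
have K20 : 0 <= K2 by rewrite /K2; lra.
apply/andP; split.
  apply: le_trans (low t _); last by lra.
  by rewrite ler_pM2l // lerXn2r ?nnegrE //; lra.
apply: le_trans (up t _) _; first by lra.
by rewrite ler_pM2l // lerXn2r ?nnegrE //; lra.
Qed.

Lemma poly_growth_sum (I : finType) (P : pred I) g L m (w : I -> R) :
  0 <= L -> (forall i, 0 <= w i) -> poly_growth g L m ->
  poly_growth (fun t => \sum_(i | P i) g (t - w i)) (#|P|%:R * L) m.
Proof.
move=> L0 w0 [K K0 KP]; have [M M0 MP] := fin_upper_bound w.
exists (K + M) => [|t tK]; first lra.
have bound i : L * (t - (K + M)) ^+ m <= g (t - w i) <= L * (t + (K + M)) ^+ m.
  have wM := MP i; have wi := w0 i.
  have /KP/andP[lo up] : K <= t - w i by lra.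
  apply/andP; split; [apply: le_trans lo|apply: le_trans up _];
    rewrite ler_wpM2l // lerXn2r ?nnegrE //; lra.
have cE (a : R) : #|P|%:R * L * a = \sum_(i | P i) L * a.
  by rewrite sumr_const -mulrA mulr_natl.
by rewrite !cE; apply/andP; split; apply: ler_sum => i _; have /andP[] := bound i.
Qed.

Lemma cvg_shift_ratio (a : R) m :
  (t + a) ^+ m / t ^+ m @[t --> +oo] --> (1 : R).
Proof.
have h1 : (t + a) / t @[t --> +oo] --> (1 : R).
  have h : 1 + a * t^-1 @[t --> +oo] --> (1 + a * 0 : R).
    apply: cvgD; first exact: cvg_cst.
    apply: cvgM; first exact: cvg_cst.
    apply/gtr0_cvgV0; last exact: cvg_id.
    by near=> t; near: t; exact: nbhs_pinfty_gt.
  rewrite mulr0 addr0 in h; apply: cvg_trans h; apply: near_eq_cvg.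
  near=> t; have t0 : 0 < t by near: t; exact: nbhs_pinfty_gt.
  by rewrite mulrDl mulfV // gt_eqF.
have -> : (fun t : R => (t + a) ^+ m / t ^+ m) = (fun t => ((t + a) / t) ^+ m).
  by apply/funext => t; rewrite expr_div_n.
elim: m => [|m IH].
  rewrite (_ : (fun t => _) = fun=> 1); first exact: cvg_cst.
  by apply/funext => t; rewrite expr0.
rewrite (_ : (fun t => _) = (fun t => (t + a) / t * ((t + a) / t) ^+ m)).
  by rewrite -[X in _ --> X](mul1r 1); exact: cvgM.
by apply/funext => t; rewrite exprS.
Unshelve. all: by end_near.
Qed.

Lemma poly_growth_cvg f L m : poly_growth f L m ->
  f t / t ^+ m @[t --> +oo] --> L.
Proof.
move=> [K K0 KP].
have lim a : L * ((t + a) ^+ m / t ^+ m) @[t --> +oo] --> L.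
  rewrite -[X in _ --> X]mulr1; apply: cvgM; first exact: cvg_cst.
  exact: cvg_shift_ratio.
apply: (squeeze_cvgr _ (lim (- K)) (lim K)); near=> t.
have t0 : 0 < t by near: t; exact: nbhs_pinfty_gt.
have tK : K <= t by near: t; exact: nbhs_pinfty_ge (num_real _).
have /andP[lo up] := KP t tK.
by rewrite !mulrA !ler_pM2r ?invr_gt0 ?exprn_gt0 // lo up.
Unshelve. all: by end_near.
Qed.

Lemma poly_growth_cvg_lt f L m c : poly_growth f L m -> (m < c)%N ->
  f t / t ^+ c @[t --> +oo] --> (0 : R).
Proof.
move=> /poly_growth_cvg fL mc.
have inv0 : (t ^+ (c - m))^-1 @[t --> +oo] --> (0 : R).
  apply/gtr0_cvgV0.
    near=> t; rewrite exprn_gt0 //; near: t; exact: nbhs_pinfty_gt.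
  apply/cvgryPge => A; near=> t.
  have t1 : 1 <= t by near: t; exact: nbhs_pinfty_ge (num_real _).
  apply: le_trans (_ : t <= _); first by near: t; exact: nbhs_pinfty_ge (num_real _).
  by apply: ler_eXnr => //; rewrite subn_gt0.
have H : f t / t ^+ m * (t ^+ (c - m))^-1 @[t --> +oo] --> (0 : R).
  by rewrite -[X in _ --> X](mulr0 L); exact: cvgM.
apply: cvg_trans H; apply: near_eq_cvg.
near=> t; have t0 : 0 < t by near: t; exact: nbhs_pinfty_gt.
by rewrite -mulrA -invfM -exprD subnKC // ltnW.
Unshelve. all: by end_near.
Qed.

End PolynomialGrowth.

(** * Walks around cycles *)

Section CycleCounts.
Variables (R : realType) (G : wgraph R) (z : vertex G).
Implicit Types (a b : vertex G) (s : seq (vertex G)).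

Lemma card1_unique (T : finType) (P : pred T) :
  #|[set e | P e]%SET| = 1%N -> exists e, P e /\ forall e', P e' -> e' = e.
Proof.
move=> /eqP/cards1P[e Pe]; exists e; split=> [|e' Pe'].
  by have := finset.set11 e; rewrite -Pe inE.
by apply/set1P; rewrite -Pe inE.
Qed.

(** On a cycle the edge inside the component is unique at each vertex, and
    following these edges one meets all vertices once before returning. *)
Lemma iwalks_cycle a b s : reduced (a :: b :: s) -> mutual a b ->
  is_cycle (induced (scc_of a)) -> exists2 d, 0 <= d & forall t,
    (cnt (iwalks z a (a :: b :: s) t))%:R =
    (cnt (iwalks z b (b :: s) (t - d)))%:R +
    (cnt (iwalks z a (a :: b :: s)
            (t - cycle_weight (induced (scc_of a)))))%:R :> R.
Proof.
move=> red mab [sC degC]; set C := induced (scc_of a).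
have aC : a \in scc_of a by rewrite mem_scc; exact: mutual_refl mab.
have bC : b \in scc_of a by rewrite mem_scc.
pose a' : vertex C := exist _ a aC; pose b' : vertex C := exist _ b bC.
have /choice[out outP] v : exists e : edge C,
    src e = v /\ forall e', src e' = v -> e' = e.
  have [_ /card1_unique[e [/eqP se eP]]] := degC v.
  by exists e; split => // e' /eqP; exact: eP.
have src_out v : src (out v) = v by case: (outP v).
have out_src e : out (src e) = e by case: (outP (src e)) => _ /(_ e erefl).
pose f v := dst (out v).
have f_inj : injective f.
  move=> u v fuv; have [/card1_unique[e [_ eP]] _] := degC (f u).
  have ue := eP (out u) (eqxx _); have ve := eP (out v) (introT eqP (esym fuv)).
  by rewrite -(src_out u) ue -ve src_out.
have f_conn u v : fconnect f u v.
  have /mutualP[/reaches_access[x wx] _] := sC u v.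
  elim: x u wx => [|e x IH] u /=; first by move=> /eqP ->; exact: connect0.
  case/andP=> /eqP <- /IH; apply: connect_trans.
  by apply: connect1; rewrite /= /f out_src.
pose w v := wt (out v).
have sumw : \sum_v w v = cycle_weight C.
  by rewrite /cycle_weight [RHS](reindex out) //; exists src => e _.
pose g (v : vertex C) t : R := (cnt (iwalks z (val v) (val v :: b :: s) t))%:R.
pose k t : R := (cnt (iwalks z b (b :: s) t))%:R.
have g_rec v t : g v t = (f v == b')%:R * k (t - w v) + g (f v) (t - w v).
  have mvb : mutual (val v) b.
    have := valP v; rewrite mem_scc mutual_sym => va; exact: mutual_trans va mab.
  have redv : reduced (val v :: b :: s).
    move: red => /=; case: (s) => // c s'; rewrite mab /= => /andP[nbc ->].
    by rewrite (negPf nbc) andbF.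
  rewrite /g cnt_iwalks_mutual // (big_pred1 (val (out v))) => [|e].
    have -> : dst (val (out v)) = val (f v) by [].
    by rewrite natrD natrM /k /w /=; congr (_%:R * _ + _).
  apply/andP/eqP => [[/eqP se me]|->]; last first.
    split; first by rewrite -[in X in _ == X](src_out v).
    have -> : dst (val (out v)) = val (f v) by [].
    have va := valP v; have fa := valP (f v); rewrite !mem_scc in va fa.
    by rewrite mutual_sym in va; exact: mutual_trans va fa.
  have sC' : src e \in scc_of a by rewrite se; exact: valP.
  have dC' : dst e \in scc_of a.
    by rewrite mem_scc; have := valP v; rewrite mem_scc => va; exact: mutual_trans va me.
  pose e' : edge C := exist _ e (introT andP (conj sC' dC')).
  have [_ /(_ e') <- //] := outP v; exact: val_inj.
have [d d0 dP] := unroll_cycle f_inj f_conn (fun v => ltW (wt_gt0 (out v))) g_rec a'.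
by exists d => // t; rewrite -sumw; exact: (dP t).
Qed.

(** The factor contributed by two consecutive entries of an itinerary: the
    density of the walks around a cycle, or the number of edges to choose from. *)
Definition pair_coef (p : vertex G * vertex G) : R :=
  if mutual p.1 p.2 then (cycle_weight (induced (scc_of p.1)))^-1
  else #|edges_between p.1 p.2|%:R.

Definition itinerary_coef s : R :=
  (\prod_(p <- pairs s) pair_coef p) / (njump s)`!%:R.

Lemma cycle_weight_gt0 (u : vertex G) :
  mutual u u -> 0 < cycle_weight (induced (scc_of u)).
Proof.
move=> uu; have uC : u \in scc_of u by rewrite mem_scc.
have [e _] := @strongly_connected_out _ (induced (scc_of u))
  (@induced_scc_strongly_connected _ _ u) (exist _ u uC).
rewrite /cycle_weight (bigD1 e) //= ltr_pwDl ?wt_gt0 //.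
by apply: sumr_ge0 => d _; rewrite ltW // wt_gt0.
Qed.

(** By induction on the itinerary: a pair on a cycle integrates, any other pair
    multiplies by the number of its edges. *)
Lemma iwalks_growth a s : reduced (a :: s) -> path (@linked R G) a s ->
  last a s = z ->
  (forall v, v \in a :: s -> mutual v v -> is_cycle (induced (scc_of v))) ->
  0 < itinerary_coef (a :: s) /\
  poly_growth (fun t => (cnt (iwalks z a (a :: s) t))%:R)
    (itinerary_coef (a :: s)) (njump (a :: s)).
Proof.
elim: s a => [|b s IH] a red.
  move=> _ /= -> _; rewrite /itinerary_coef njump1 big_nil fact0 divr1.
  split=> //; exists 0 => // t t0; rewrite cnt_iwalks1 eqxx t0 !expr0 mulr1.
  by rewrite lexx.
move=> /= /andP[ab sp] sz cyc.
have redb : reduced (b :: s) by case/andP: red.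
have [coef0 growb] := IH b redb sp sz
  (fun v vs => cyc v (@mem_behead _ (a :: b :: s) _ vs)).
have coefE : itinerary_coef (a :: b :: s) =
    pair_coef (a, b) * itinerary_coef (b :: s) *
    ((njump (b :: s))`!%:R / (njump (a :: b :: s))`!%:R).
  rewrite /itinerary_coef /pairs /= big_cons -/(pairs (b :: s)).
  have fb : (njump (b :: s))`!%:R != 0 :> R by rewrite pnatr_eq0 -lt0n fact_gt0.
  have fab : (njump (a :: b :: s))`!%:R != 0 :> R by rewrite pnatr_eq0 -lt0n fact_gt0.
  by field; rewrite fb fab.
have [mab|nab] := boolP (mutual a b).
  have caa := mutual_refl mab; have w0 := cycle_weight_gt0 caa.
  have ncyc := cyc a (mem_head _ _) caa.
  have [d d0 dP] := iwalks_cycle red mab ncyc.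
  have nE : njump (a :: b :: s) = (njump (b :: s)).+1 by rewrite njump_cons mab.
  have cE : itinerary_coef (a :: b :: s) = itinerary_coef (b :: s) /
      ((njump (b :: s)).+1%:R * cycle_weight (induced (scc_of a))).
    rewrite coefE nE factS natrM /pair_coef /= mab.
    have fb : (njump (b :: s))`!%:R != 0 :> R by rewrite pnatr_eq0 -lt0n fact_gt0.
    have n0 : (njump (b :: s)).+1%:R != 0 :> R by rewrite pnatr_eq0.
    have H (u v q y : R) : u != 0 -> v != 0 -> q != 0 ->
        q^-1 * y * (u / (v * u)) = y / (v * q).
      by move=> u0 v0 q0; field; rewrite u0 v0 q0.
    by apply: H => //; rewrite gt_eqF.
  rewrite cE nE; split; first by rewrite divr_gt0 // mulr_gt0 // ltr0n.
  apply: (poly_growth_cycle coef0 d0 w0 _ _ dP growb) => [t|t t' tt'].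
    exact: ler0n.
  by rewrite ler_nat cnt_iwalks_le.
have E0 : (0 < #|edges_between a b|)%N.
  by move: ab; rewrite /linked (negPf nab) /= -card_gt0.
have nE : njump (a :: b :: s) = njump (b :: s) by rewrite njump_cons (negPf nab).
have cE : itinerary_coef (a :: b :: s) =
    #|edges_between a b|%:R * itinerary_coef (b :: s).
  rewrite coefE nE divff ?mulr1 ?pnatr_eq0 -?lt0n ?fact_gt0 //.
  by rewrite /pair_coef /= (negPf nab).
rewrite cE nE; split; first by rewrite mulr_gt0 // ltr0n.
have := poly_growth_sum (mem (edges_between a b)) (ltW coef0)
  (fun e : edge G => ltW (wt_gt0 e)) growb.
congr poly_growth; apply/funext => t.
by rewrite cnt_iwalks_edge // natr_sum.
Qed.

End CycleCounts.

(** * Graphs all of whose components are cycles *)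

Section PolynomialLimit.
Variable R : realType.

Lemma cvg_seq_sum (I : eqType) (r : seq I) (F : I -> R -> R) (l : I -> R) :
  (forall i, i \in r -> F i t @[t --> +oo] --> l i) ->
  (\sum_(i <- r) F i t) @[t --> +oo] --> \sum_(i <- r) l i.
Proof.
elim: r => [|i r IH] H.
  rewrite big_nil (_ : (fun t => _) = fun=> 0); first exact: cvg_cst.
  by apply/funext => t; rewrite big_nil.
rewrite big_cons (_ : (fun t => _) = (fun t => F i t + \sum_(j <- r) F j t)).
  apply: cvgD; first by apply: H; exact: mem_head.
  by apply: IH => j jr; apply: H; rewrite inE jr orbT.
by apply/funext => t; rewrite big_cons.
Qed.

(** [N (p r - 1) < r <= N (p r)], and both ends grow like [L * p r ^+ c]. *)
Lemma polynomial_growth_limit (p : nat -> R) (N : R -> nat) (c : nat) (L : R) :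
  (forall r, (0 < r)%N ->
     (r <= N (p r))%N /\ forall t, t < p r -> (N t < r)%N) ->
  (forall t t', t <= t' -> (N t <= N t')%N) ->
  (forall d, 0 <= d -> (N (t - d))%:R / t ^+ c @[t --> +oo] --> L) -> 0 < L ->
  (fun r : nat => p r ^+ c / r%:R) @ \oo --> L^-1.
Proof.
move=> pN Nmono NL L0.
have py : p @ \oo --> +oo.
  apply/cvgryPge => A; exists (N A).+1 => // r /= Ar.
  have [rN _] := pN r (leq_trans (ltn0Sn _) Ar).
  rewrite leNgt; apply/negP => pA; have := Nmono _ _ (ltW pA); lia.
have lim0 : (N (p r - 0))%:R / p r ^+ c @[r --> \oo] --> L.
  exact: (cvg_comp _ _ py (NL 0 (lexx 0))).
have lim1 : (N (p r - 1))%:R / p r ^+ c @[r --> \oo] --> L.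
  exact: (cvg_comp _ _ py (NL 1 ler01)).
have lim : r%:R / p r ^+ c @[r --> \oo] --> L.
  apply: (squeeze_cvgr _ lim1 lim0); near=> r.
  have p0 : 0 < p r by near: r; move/cvgryPgt: py; apply.
  have r0 : (0 < r)%N by near: r; exists 1%N.
  have [rN Nr] := pN r r0.
  rewrite !ler_pM2r ?invr_gt0 ?exprn_gt0 // !ler_nat subr0 rN andbT.
  by apply: ltnW; apply: Nr; lra.
have -> : (fun r : nat => p r ^+ c / r%:R) = (fun r => (r%:R / p r ^+ c)^-1).
  by apply/funext => r; rewrite invf_div.
by apply: cvgV => //; rewrite gt_eqF.
Unshelve. all: by end_near.
Qed.

End PolynomialLimit.

Section ItinerarySum.
Variables (R : realType) (G : wgraph R).
Implicit Types (s : seq (vertex G)).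

Lemma big_pairs (T : Type) (idx : T) (op : T -> T -> T) d s
    (F : vertex G -> vertex G -> T) :
  \big[op/idx]_(i < (size s).-1) F (nth d s i) (nth d s i.+1) =
  \big[op/idx]_(p <- pairs s) F p.1 p.2.
Proof.
case: s => [|a s]; first by rewrite big_ord0 big_nil.
elim: s a => [|b s IH] a; first by rewrite big_ord0 big_nil.
by rewrite /pairs /= big_ord_recl big_cons /=; congr op; exact: IH.
Qed.

Lemma card_J1 d s : #|J1 d s| = njump s.
Proof.
rewrite /njump -(big_pairs 0%N addn d s (fun a b => nat_of_bool (mutual a b))).
rewrite -sum1_card big_mkcond /=; apply: eq_bigr => i _.
by rewrite inE; case: mutual.
Qed.

Lemma itinerary_coefE d s c : #|J1 d s| = c ->
  (\prod_(i in J2 d s) #|edges_between (nth d s i) (nth d s i.+1)|%:R)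
   / (c`!%:R * \prod_(i in J1 d s) cycle_weight (induced (scc_of (nth d s i))))
  = itinerary_coef s.
Proof.
move=> <-; rewrite /itinerary_coef card_J1 invfM mulrA mulrAC; congr (_ / _).
pose F (a b : vertex G) : R := pair_coef (a, b).
transitivity (\prod_(p <- pairs s) F p.1 p.2); last by apply: eq_bigr => -[].
rewrite -(big_pairs 1 *%R d s F) [RHS](bigID (fun i => i \in J1 d s)) /= mulrC -prodfV.
congr (_ * _); apply: eq_big => i; rewrite ?inE // => iJ; rewrite /F /pair_coef /=.
  by rewrite iJ.
by rewrite (negPf iJ).
Qed.

Lemma itinerary_coef_ge0 s : 0 <= itinerary_coef s :> R.
Proof.
rewrite divr_ge0 ?ler0n //; apply: prodr_ge0 => p _; rewrite /pair_coef.
case: ifP => _; rewrite ?ler0n // invr_ge0.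
by apply: sumr_ge0 => e _; rewrite ltW // wt_gt0.
Qed.

Lemma linked_reaches (a b : vertex G) : linked a b -> reaches a b.
Proof.
case/orP => [/mutualP[]//|/set0Pn[e]].
by rewrite inE => /andP[/eqP <- /eqP <-]; exact: reaches_edge.
Qed.

(** Two steps of a reduced list always leave a component. *)
Lemma size_reduced a s : reduced (a :: s) -> path (@linked R G) a s ->
  (size (a :: s) <= (rank a).*2)%N.
Proof.
have [n] := ubnP (size s); elim: n a s => // n IH a s sn red ps.
have ra := rank_gt0 a.
case: s sn red ps => [|b [|c s]] sn red ps; try by rewrite /=; lia.
move: ps => /= /and3P[/linked_reaches ab /linked_reaches bc pc].
have ab' := reaches_access ab; have bc' := reaches_access bc.
have rlt : (rank c < rank a)%N.
  apply: rank_lt; first exact: access_trans ab' bc'.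
  move=> ca; move: red => /= /andP[/negP + _]; apply; apply/andP; split.
    by apply: access_mutual => //; exact: access_trans bc' ca.
  by apply: access_mutual => //; exact: access_trans ca ab'.
have redc : reduced (c :: s) by move: red => /= /and3P[_ _].
have sn' : (size s < n)%N by move: sn => /=; lia.
by have := IH c s sn' redc pc; rewrite /=; lia.
Qed.

End ItinerarySum.

Section CycleComponents.
Variables (R : realType) (G : wgraph R) (v1 v2 : vertex G).
Local Notation X := (paths v1 v2).
Local Notation U := (Vt X).
Local Notation It := (itineraries X).
Local Notation Xle t := (X `&` [set x | path_weight x <= t]).
Hypothesis X_neq0 : X !=set0.

Lemma pathsE x : X x <-> x != [::] /\ walk v1 v2 x.
Proof. by rewrite /paths /= path_betweenE; split=> /andP. Qed.

Lemma itinerariesE s : It s <->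
  exists2 x, X x & s = shorten (v1 :: map dst x).
Proof.
split=> -[x Xx]; have [x0 wx] := (pathsE x).1 Xx.
  move/is_itineraryE => ->; exists x => //.
  by rewrite (vertex_listE wx x0).
by move=> ->; exists x => //; apply/is_itineraryE; rewrite (vertex_listE wx x0).
Qed.

Lemma walk_linked (u v : vertex G) x :
  walk u v x -> path (@linked R G) u (map dst x).
Proof.
elim: x u => //= e x IH u /andP[/eqP <- /IH ->]; rewrite andbT /linked.
by apply/orP; right; apply/set0Pn; exists e; rewrite inE !eqxx.
Qed.

Lemma itinerariesP s : It s -> exists b r, [/\ s = v1 :: b :: r, reduced s,
  path (@linked R G) v1 (b :: r), last v1 (b :: r) = v2 &
  forall v, v \in s -> v \in U].
Proof.
move=> /itinerariesE[x Xx ->]; have [x0 wx] := (pathsE x).1 Xx.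
have [r [E pr lr sr]] := shorten_path (walk_linked wx).
have [b [r' E']] : exists b r', shorten (v1 :: map dst x) = v1 :: b :: r'.
  by case: (x) x0 => // e y _; exact: (shorten_head2 v1 (dst e) (map dst y)).
have rE : r = b :: r' by move: E'; rewrite E => -[].
exists b, r'; rewrite E -rE; split=> //.
- by rewrite -E; exact: shorten_reduced.
- by rewrite lr (walk_last wx).
- move=> v vr; rewrite inE; apply/asboolP; exists x => //.
  rewrite (vertex_listE wx x0); move: vr; rewrite inE => /predU1P[->|/sr//].
  exact: mem_head.
Qed.

Lemma finite_itineraries : finite_set It.
Proof.
apply: sub_finite_set (finite_seq_size _ (rank v1).*2) => s /itinerariesP.
by move=> [b [r [-> red pr _ _]]]; exact: size_reduced.
Qed.

Lemma cnt_paths_itineraries t :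
  cnt (Xle t) = (\sum_(s <- fset_set It) cnt (iwalks v2 v1 s t))%N.
Proof.
rewrite (@cnt_partition _ _ (fun x => shorten (v1 :: map dst x)) (fset_set It)).
- rewrite big_seq [RHS]big_seq; apply: eq_bigr => s.
  rewrite in_fset_set; last exact: finite_itineraries.
  move=> /set_mem/itinerariesP[b [r [sE _ _ _ _]]].
  congr cnt; apply/seteqP; split => x.
    by move=> [[/pathsE[_ wx] xt] xs]; split.
  move=> [wx xs xt]; split=> //; split=> //; apply/pathsE; split=> //.
  by apply/eqP => x0; move: xs; rewrite x0 sE.
- exact: fset_uniq.
- exact: finite_sublevel.
- move=> x [Xx _]; rewrite in_fset_set; last exact: finite_itineraries.
  by apply/mem_set/itinerariesE; exists x.
Qed.

Lemma njump_met x : X x ->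
  (njump (shorten (v1 :: map dst x)) <= nb_sccs_met U x)%N.
Proof.
move=> Xx; have [x0 wx] := (pathsE x).1 Xx.
rewrite (njump_shorten wx); apply: subset_leq_card; apply/fintype.subsetP => C.
move=> /traversedP[e [ex me ->]].
have ev : src e \in vertex_list x.
  rewrite (vertex_listE wx x0); elim: x {Xx x0} v1 wx ex => //= d x IH u.
  case/andP=> /eqP <- wx; rewrite inE => /predU1P[->|ex].
    by rewrite mem_head.
  by rewrite inE (IH _ wx ex) orbT.
rewrite inE; apply/andP; split.
  apply/sccs_onP; first exact: convex_Vt.
  exists (src e); split=> //; last exact: mutual_refl me.
  by rewrite inE; apply/asboolP; exists x.
by apply/existsP; exists (src e); rewrite mem_scc (mutual_refl me).
Qed.

Lemma met_njump x : X x -> exists2 y, X y &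
  (nb_sccs_met U x <= njump (shorten (v1 :: map dst y)))%N.
Proof.
move=> Xx; have [x0 wx] := (pathsE x).1 Xx.
have [y [wy /(_ x0) y0 yP]] := exists_traversing wx.
exists y; first by apply/pathsE.
rewrite (njump_shorten wy); apply: subset_leq_card; apply/fintype.subsetP => C.
rewrite inE => /andP[/sccs_onP-/(_ (convex_Vt X_neq0))[u [_ uu ->]]].
move=> /existsP[v /andP[]]; rewrite mem_scc (vertex_listE wx x0) => uv vx.
by rewrite (scc_of_eq uv); apply: yP => //; rewrite mutual_sym in uv; exact: mutual_refl uv.
Qed.

Lemma growth_cycle (c : nat) (s : R) :
  sccs_on U <> finset.set0 ->
  (forall C, C \in sccs_on U -> is_cycle (induced C)) ->
  [set nb_sccs_met U x | x in X] c ->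
  ubound [set nb_sccs_met U x | x in X] c ->
  1 / s = \sum_(sigma \in It `&` [set sigma | #|J1 v1 sigma| = c])
     ((\prod_(i in J2 v1 sigma)
        #|edges_between (nth v1 sigma i) (nth v1 sigma i.+1)|%:R)
      / (c`!%:R * \prod_(i in J1 v1 sigma)
           cycle_weight (induced (scc_of (nth v1 sigma i))))) ->
  (fun r : nat => weight_seq X r ^+ c / r%:R) @ \oo --> s.
Proof.
move=> sccs0 cyc [x Xx xc] cub sE.
have cyc' v : v \in U -> mutual v v -> is_cycle (induced (scc_of v)).
  move=> vU vv; apply: cyc; apply/sccs_onP; first exact: convex_Vt.
  by exists v.
have njc sg : It sg -> (njump sg <= c)%N.
  move=> /itinerariesE[y Xy ->]; apply: leq_trans (njump_met Xy) _.
  by apply: cub; exists y.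
have growth sg : It sg -> 0 < itinerary_coef sg /\
    poly_growth (fun t => (cnt (iwalks v2 v1 sg t))%:R)
      (itinerary_coef sg) (njump sg).
  move=> /itinerariesP[b [r [-> red pr lr vU]]].
  by apply: iwalks_growth => // v /vU; exact: cyc'.
have [sg0 Isg0 nsg0] : exists2 sg, It sg & njump sg = c.
  have [y Xy xy] := met_njump Xx.
  have Iy : It (shorten (v1 :: map dst y)) by apply/itinerariesE; exists y.
  by exists (shorten (v1 :: map dst y)) => //; apply/eqP; rewrite eqn_leq njc // -xc.
pose L := \sum_(sg <- fset_set It) (if njump sg == c then itinerary_coef sg else 0).
have mem_It sg : (sg \in fset_set It) = `[< It sg >].
  by rewrite in_fset_set //; exact: finite_itineraries.
have LE : 1 / s = L.
  have fItc : finite_set (It `&` [set sigma | #|J1 v1 sigma| = c]).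
    by apply: finite_setIl; exact: finite_itineraries.
  rewrite sE fsbig_finite //.
  rewrite /L -big_mkcond -[RHS]big_filter /=.
  transitivity (\sum_(sg <- fset_set (It `&` [set sigma | #|J1 v1 sigma| = c]))
    itinerary_coef sg).
    apply: eq_big_seq => sg; rewrite in_fset_set //.
    by move=> /set_mem[_ /itinerary_coefE ->].
  apply: perm_big; apply: uniq_perm; rewrite ?filter_uniq ?fset_uniq // => sg.
  rewrite mem_filter mem_It in_fset_set //.
  apply/idP/andP => [/set_mem[Isg /= <-]|[/eqP nc /asboolP Isg]].
    by rewrite card_J1; split => //; apply/asboolP.
  by apply/mem_set; split=> //=; rewrite card_J1.
have L0 : 0 < L.
  have sg0I : sg0 \in fset_set It by rewrite mem_It; apply/asboolP.
  rewrite /L (big_fsetD1 sg0) //= nsg0 eqxx ltr_pwDl //.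
    by have [] := growth _ Isg0.
  by apply: sumr_ge0 => sg _; case: ifP => // _; exact: itinerary_coef_ge0.
have c0 : (0 < c)%N.
  have /set0Pn[C CU] : sccs_on U != finset.set0 by apply/eqP.
  have /sccs_onP-/(_ (convex_Vt X_neq0))[u [uU uu CE]] := CU.
  have := uU; rewrite inE => /asboolP[y Xy uy].
  apply: leq_trans (cub (nb_sccs_met U y) (ex_intro2 _ _ y Xy erefl)).
  apply/card_gt0P; exists C; rewrite inE CU; apply/existsP; exists u.
  by rewrite CE mem_scc uu.
have NL d : 0 <= d -> (cnt (Xle (t - d)))%:R / t ^+ c @[t --> +oo] --> L.
  move=> d0.
  rewrite (_ : (fun t => _) = (fun t => \sum_(sg <- fset_set It)
      (cnt (iwalks v2 v1 sg (t - d)))%:R / t ^+ c)); last first.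
    by apply/funext => t; rewrite cnt_paths_itineraries natr_sum mulr_suml.
  apply: cvg_seq_sum => sg; rewrite mem_It => /asboolP Isg.
  have [coef0 gr] := growth sg Isg.
  have gr' := poly_growth_shift (ltW coef0) d0 gr.
  case: eqP => [<-|/eqP ne]; first exact: (poly_growth_cvg gr').
  by apply: (poly_growth_cvg_lt gr'); rewrite ltn_neqAle ne njc.
have Xinf : infinite_set X.
  move=> Xfin.
  have bnd : poly_growth (fun=> (cnt X)%:R : R) (cnt X)%:R 0.
    by exists 0 => // t _; rewrite !expr0 mulr1 lexx.
  have H0 := poly_growth_cvg_lt bnd c0.
  have : L <= 0.
    apply: ler_cvg_to (NL 0 (lexx 0)) H0 _; near=> t.
    have t0 : 0 < t by near: t; exact: nbhs_pinfty_gt.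
    rewrite ler_pM2r ?invr_gt0 ?exprn_gt0 // ler_nat.
    by apply: cnt_le => // y [].
  by rewrite leNgt L0.
have -> : s = L^-1 by rewrite -LE mul1r invrK.
apply: (polynomial_growth_limit (weight_seq_count Xinf) _ NL L0) => t t' tt'.
apply: cnt_le; first exact: finite_sublevel.
by move=> y [Xy yt]; split => //; exact: le_trans yt tt'.
Unshelve. all: by end_near.
Qed.

End CycleComponents.

(** * The theorem *)

(** Without components the rank drops at every edge, which bounds the length of
    a path. *)
Lemma no_component_finite (R : realType) (G : wgraph R) (v1 v2 : vertex G) :
  paths v1 v2 !=set0 -> sccs_on (Vt (paths v1 v2)) = finset.set0 ->
  finite_set (paths v1 v2).
Proof.
move=> X0 nscc; apply: sub_finite_set (finite_seq_size _ (rank v1)) => x Xx /=.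
have {Xx} [x0 wx] := (pathsE v1 v2 x).1 Xx.
suff H u : access v1 u -> forall y, walk u v2 y -> (size y <= rank u)%N.
  exact: H (access_refl v1) x wx.
move=> + y; elim: y u => //= e y IH u v1u /andP[/eqP su wy].
have v1e : access v1 (dst e).
  by rewrite -su in v1u; exact: access_trans v1u (access_edge e).
apply: leq_ltn_trans (IH _ v1e wy) _.
rewrite -su; apply: rank_edge_lt; apply/negP => me.
have : scc_of u \in sccs_on (Vt (paths v1 v2)).
  apply/sccs_onP; first exact: convex_Vt.
  exists u; split=> //; last by rewrite -su; exact: mutual_refl me.
  apply/VtP => //; split=> //; rewrite -su.
  by apply: access_trans (access_edge e) _; exists y.
by rewrite nscc inE.
Qed.

Theorem theorem2p1 (R : realType) (G : wgraph R) (v1 v2 : vertex G) :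
  let X := paths v1 v2 in
  let p := weight_seq X in
  X !=set0 ->
  [/\ (* 1 *)
      sccs_on (Vt X) = finset.set0 -> finite_set X,
      (* 2 *)
      sccs_on (Vt X) <> finset.set0 ->
      (forall C, C \in sccs_on (Vt X) -> is_cycle (induced C)) ->
      forall (c : nat) (s : R),
        [set nb_sccs_met (Vt X) x | x in X] c ->
        ubound [set nb_sccs_met (Vt X) x | x in X] c ->
        1 / s = \sum_(sigma \in itineraries X `&`
                               [set sigma | #|J1 v1 sigma| = c])
                  ((\prod_(i in J2 v1 sigma)
                      #|edges_between (nth v1 sigma i) (nth v1 sigma i.+1)|%:R)
                   / (c`!%:R * \prod_(i in J1 v1 sigma)
                        cycle_weight (induced (scc_of (nth v1 sigma i))))) ->
        (fun r : nat => p r ^+ c / r%:R) @ \oo --> s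
    & (* 3 *)
      (exists2 C, C \in sccs_on (Vt X) & ~ is_cycle (induced C)) ->
      forall s : R,
        let S := [set s_value (induced C) | C in
                  [set C | C \in sccs_on (Vt X) /\ ~ is_cycle (induced C)]] in
        S s -> lbound S s ->
        (fun r : nat => p r / ln r%:R) @ \oo --> s].
Proof.
move=> X p X0; split.
- exact: no_component_finite.
- by move=> scc0 cyc c s; exact: growth_cycle.
- by move=> _ s; exact: growth_noncycle.
Qed.
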